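(* Let $C$ be a cusp in $(\mathbb{C}^2,0)$ with Puiseux pair $(m,n)$, and let $\Lambda_C$ be its semimodule of differential values, of length $s$, with last axis $\tilde u_{s+1}$. Then the conductor of $\Lambda_C$ is $$c(\Lambda_C)=\tilde u_{s+1}-n-m+1.$$
   Context: A cusp with Puiseux pair $(m,n)$ is an irreducible plane curve germ at $0\in\mathbb C^2$ with only one Puiseux pair $(m,n)$, $2\le n<m$, $\gcd(n,m)=1$. Let $\gamma(t)$ be a primitive parametrization of $C$. For a holomorphic function germ $h$, $\nu_C(h)=\operatorname{ord}_t h(\gamma(t))$; for a holomorphic 1-form germ $\omega$, $\nu_C(\omega)=\operatorname{ord}_t(\alpha(t))+1$ where $\gamma^*\omega=\alpha(t)\,dt$. The semigroup is $\Gamma_C=\{\nu_C(h)\}=\{an+bm: a,b\in\mathbb{Z}_{\ge0}\}$, and $\Lambda_C$ is the set of all (finite) differential values $\nu_C(\omega)$; it satisfies $\Lambda_C+\Gamma_C\subset\Lambda_C$. The conductor $c(\Lambda_C)$ is the smallest non-negative integer such that every integer greater than or equal to it belongs to $\Lambda_C$. The basis of $\Lambda_C$ is the unique strictly increasing sequence $(\lambda_{-1},\lambda_0,\ldots,\lambda_s)$, $s$ minimal, with $\Lambda_C=\bigcup_{i=-1}^s(\lambda_i+\Gamma_C)$ ($\lambda_{-1}=n$, $\lambda_0=m$); $s$ is the length of $\Lambda_C$. Put $\Lambda_j=\bigcup_{k=-1}^j(\lambda_k+\Gamma_C)$. For $1\le i\le s+1$: $u_i^n=\min\{\lambda_{i-1}+n\ell\in\Lambda_{i-2}:\ell\ge1\}$,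 $u_i^m=\min\{\lambda_{i-1}+m\ell\in\Lambda_{i-2}:\ell\ge1\}$, and $\tilde u_i=\max\{u_i^n,u_i^m\}$. *)

(* Defs.v *)
From HB Require Import structures.
From mathcomp Require Import all_boot all_order all_algebra complex.
From mathcomp Require Import boolp classical_sets reals.

Set Implicit Arguments.
Unset Strict Implicit.
Unset Printing Implicit Defensive.

Import Order.TTheory GRing.Theory Num.Theory.

Local Open Scope classical_set_scope.
Local Open Scope ring_scope.
Local Open Scope complex_scope.

(* The complex field is R[i] for R : realType.  Germs of holomorphic functions
   at the origin are convergent power series, given by their coefficients:
   a : nat -> R[i] stands for \sum_k a k * t^k, and
   h : nat -> nat -> R[i] stands for \sum_(i, j) h i j * x^i * y^j. *)

(* Absolute convergence at some positive radius r: the partial sums of a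
   series of nonnegative terms are bounded. *)
Definition convergent1 (R : realType) (a : nat -> R[i]) : Prop :=
  exists r M : R, 0 < r /\
    forall N : nat, \sum_(k < N) `|a k| * r%:C ^+ k <= M%:C.

Definition convergent2 (R : realType) (h : nat -> nat -> R[i]) : Prop :=
  exists r M : R, 0 < r /\
    forall N : nat, \sum_(i < N) \sum_(j < N) `|h i j| * r%:C ^+ (i + j) <= M%:C.

Definition mul1 (R : realType) (a b : nat -> R[i]) : nat -> R[i] :=
  fun k => \sum_(i < k.+1) a i * b (k - i)%N.

Definition pow1 (R : realType) (a : nat -> R[i]) (e : nat) : nat -> R[i] :=
  iter e (mul1 a) (fun k => (k == 0)%N%:R).

Definition mul2 (R : realType) (g h : nat -> nat -> R[i]) :
    nat -> nat -> R[i] :=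
  fun i j => \sum_(p < i.+1) \sum_(q < j.+1) g p q * h (i - p)%N (j - q)%N.

(* Composition a(b(t)), meaningful when b 0 = 0: then b^i has no term of degree
   < i, so that only i <= k contributes to degree k.  The same remark applies
   to h(x(t), y(t)) below when x 0 = y 0 = 0. *)
Definition comp1 (R : realType) (a b : nat -> R[i]) : nat -> R[i] :=
  fun k => \sum_(i < k.+1) a i * pow1 b i k.

Definition comp2 (R : realType) (h : nat -> nat -> R[i]) (x y : nat -> R[i]) :
    nat -> R[i] :=
  fun k => \sum_(i < k.+1) \sum_(j < k.+1)
             h i j * mul1 (pow1 x i) (pow1 y j) k.

Definition deriv1 (R : realType) (a : nat -> R[i]) : nat -> R[i] :=
  fun k => k.+1%:R * a k.+1.

(* The order of a is finite and equal to k. *)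
Definition has_order (R : realType) (a : nat -> R[i]) (k : nat) : Prop :=
  a k != 0 /\ forall i : nat, (i < k)%N -> a i = 0.

(* Irreducibility in the ring of convergent power series, whose units are the
   series with nonzero constant term; f != 0 is implied since 0 = 0 * 0. *)
Definition irreducible2 (R : realType) (f : nat -> nat -> R[i]) : Prop :=
  f 0%N 0%N = 0 /\
  forall g h : nat -> nat -> R[i], convergent2 g -> convergent2 h ->
    (forall i j, f i j = mul2 g h i j) -> g 0%N 0%N != 0 \/ h 0%N 0%N != 0.

(* A germ of parametrized curve t |-> (x(t), y(t)) at the origin. *)
Definition parametrization (R : realType) (x y : nat -> R[i]) : Prop :=
  [/\ convergent1 x, convergent1 y, x 0%N = 0 & y 0%N = 0].

(* (x, y) does not factor through a map t |-> s(t) with s(0) = s'(0) = 0; the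
   case s = 0 excludes the constant parametrization. *)
Definition primitive (R : realType) (x y : nat -> R[i]) : Prop :=
  ~ exists x' y' s : nat -> R[i],
      [/\ parametrization x' y', convergent1 s, s 0%N = 0 & s 1%N = 0]
      /\ (forall k, x k = comp1 x' s k) /\ (forall k, y k = comp1 y' s k).

(* In suitable linear coordinates (a x + b y, c x + d y) and after a
   reparametrization t |-> tau(t), the curve is (t^n, phi(t)), i.e. it has the
   Puiseux series phi(x^(1/n)), where m is the first exponent of phi that is not
   divisible by n.  As gcd(n, m) = 1, this is the only Puiseux pair; as n < m,
   phi has order at least n, so the coordinates are transversal and n is the
   multiplicity. *)
Definition single_puiseux_pair (R : realType) (m n : nat) (x y : nat -> R[i]) :
    Prop :=
  [/\ (2 <= n)%N, (n < m)%N & coprime n m] /\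
  exists (a b c d : R[i]) (tau phi : nat -> R[i]),
    [/\ a * d - b * c != 0, convergent1 tau, tau 0%N = 0 & tau 1%N != 0]
    /\ [/\ (forall k, comp1 (fun i => a * x i + b * y i) tau k = (k == n)%N%:R),
           (forall k, comp1 (fun i => c * x i + d * y i) tau k = phi k),
           phi 0%N = 0,
           (forall i : nat, (i < m)%N -> ~~ (n %| i)%N -> phi i = 0)
         & phi m != 0].

(* The curve f = 0 with a primitive parametrization (param_x, param_y). *)
Record cusp (R : realType) (m n : nat) := Cusp {
  equation : nat -> nat -> R[i];
  param_x : nat -> R[i];
  param_y : nat -> R[i];
  equation_convergent : convergent2 equation;
  equation_irreducible : irreducible2 equation;
  param_parametrization : parametrization param_x param_y;
  param_primitive : primitive param_x param_y;
  param_equation : forall k, comp2 equation param_x param_y k = 0;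
  param_puiseux : single_puiseux_pair m n param_x param_y
}.

Definition Gamma (R : realType) (m n : nat) (C : cusp R m n) : set nat :=
  [set v | exists h : nat -> nat -> R[i],
     convergent2 h /\ has_order (comp2 h (param_x C) (param_y C)) v].

(* Coefficients of alpha, where alpha dt is the pullback of A dx + B dy. *)
Definition pullback (R : realType) (A B : nat -> nat -> R[i])
    (x y : nat -> R[i]) : nat -> R[i] :=
  fun k => mul1 (comp2 A x y) (deriv1 x) k + mul1 (comp2 B x y) (deriv1 y) k.

Definition Lambda (R : realType) (m n : nat) (C : cusp R m n) : set nat :=
  [set v | exists (A B : nat -> nat -> R[i]) (k : nat),
     [/\ convergent2 A, convergent2 B,
         has_order (pullback A B (param_x C) (param_y C)) k & v = k.+1]].

Definition semimodule_gen (G : set nat) (mu : seq nat) : set nat :=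
  [set v | exists l g : nat, [/\ l \in mu, G g & v = (l + g)%N]].

(* Strictly increasing generating sequence of minimal length. *)
Definition is_basis (G L : set nat) (lam : seq nat) : Prop :=
  [/\ sorted ltn lam, L = semimodule_gen G lam &
      forall mu : seq nat, sorted ltn mu -> L = semimodule_gen G mu ->
        (size lam <= size mu)%N].

(* The minimum of a set of natural numbers (0 for the empty set). *)
Definition least (A : set nat) : nat :=
  xget 0%N [set k | A k /\ forall j, A j -> (k <= j)%N].

Lemma leastP (A : set nat) :
  A !=set0 -> A (least A) /\ forall j, A j -> (least A <= j)%N.
Proof.
move=> [k Ak]; apply: (@xgetPex _ 0%N [set k | A k /\ forall j, A j -> (k <= j)%N]).
have exA : exists k, `[< A k >] by exists k; apply/asboolP.
exists (ex_minn exA); case: ex_minnP => p /asboolP Ap minp.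
by split=> // j Aj; apply/minp/asboolP.
Qed.

Definition conductor (L : set nat) : nat :=
  least [set c | forall k : nat, (c <= k)%N -> L k].

(* Indices are shifted by one: the basis (lambda_{-1}, ..., lambda_s) is the
   list lam, so that lambda_{i-1} = nth 0 lam i and Lambda_{i-2} is generated
   by take i lam = [:: lambda_{-1}; ...; lambda_{i-2}].  With p = n and p = m
   this is u_i^n and u_i^m, for 1 <= i <= s + 1. *)
Definition axis_dir (G : set nat) (lam : seq nat) (p i : nat) : nat :=
  least [set v | semimodule_gen G (take i lam) v /\
                 exists l : nat, (1 <= l)%N /\ v = (nth 0%N lam i + p * l)%N].

Definition axis (G : set nat) (lam : seq nat) (m n i : nat) : nat :=
  maxn (axis_dir G lam n i) (axis_dir G lam m i).

(* Main.v *)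
Require Import Defs.
From mathcomp Require Import all_boot all_order all_algebra complex.
From mathcomp Require Import boolp classical_sets reals.
From mathcomp Require Import zify ring.

(* Write G for the semigroup of m, n.  Placing a*n + b*m at the lattice point
   (a, b), modulo the period (-m, n), turns a G-semimodule into a staircase, and
   its conductor is the value of the highest outer corner minus n + m - 1.  A
   new generator lambda_i lying above the lower axis u_i, hence under the corner
   of the upper one, replaces that corner by two others, u_(i+1) and
   ~u_(i+1); so if lambda_i > u_i for all i, the highest corner of the whole
   semimodule is the last upper axis.

   The inequalities lambda_i > u_i (Delorme) come from a standard basis
   argument.  A form whose value is the next generator is a combination of the
   previous forms in which the terms of lowest order cancel; cancellations below
   u_i can be rewritten away, so this order is at least u_i.  Moreover the
   reduction of the S-pair at u_i has value exactly lambda_i, so that it can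
   serve as the next form, and the cancellations below ~u_i are again
   removable.

   Orders below N depend only on the power series modulo t^N, so everything is
   done with polynomials in t. *)

Set Implicit Arguments.
Unset Strict Implicit.
Unset Printing Implicit Defensive.

Local Open Scope classical_set_scope.
Local Open Scope nat_scope.

(** * Semimodules as staircases *)

Definition semigroup2 (n m : nat) : set nat :=
  [set v | exists a b, v = a * n + b * m].

Definition first_gen (l : nat -> nat) (G : set nat) (i : nat) : set nat :=
  [set v | exists k g, [/\ k < i, G g & v = l k + g]].

Lemma leq_exD p q : p <= q -> exists k, q = p + k.
Proof. by move=> le; exists (q - p); lia. Qed.

Section Semigroup.
Variables n m : nat.
Hypotheses (n_gt0 : 0 < n) (m_gt0 : 0 < m) (co_nm : coprime n m).
Local Notation G := (semigroup2 n m).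

Lemma semigroup2D u v : G u -> G v -> G (u + v).
Proof.
by move=> [a [b ->]] [c [d ->]]; exists (a + c), (b + d); rewrite !mulnDl addnACA.
Qed.

Lemma semigroup2_mull a : G (a * n). Proof. by exists a, 0; rewrite addn0. Qed.

Lemma semigroup2_mulr b : G (b * m). Proof. by exists 0, b. Qed.

Lemma leq_of_muln_eq p q : 0 < p -> p * n = q * m -> n <= q.
Proof.
move=> p0 e; apply: dvdn_leq.
  by case: q e => // e; move: (muln_gt0 p n); rewrite e p0 n_gt0.
by rewrite -(Gauss_dvdl _ co_nm) -e dvdn_mull.
Qed.

Lemma leq_of_muln_eqr p q : 0 < q -> p * n = q * m -> m <= p.
Proof.
move=> q0 e; apply: dvdn_leq.
  by case: p e => // e; move: (muln_gt0 q m); rewrite -e q0 m_gt0.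
by rewrite -(@Gauss_dvdl _ _ n) 1?coprime_sym // e dvdn_mull.
Qed.

Lemma semigroup2_inj a b c d : a * n + b * m < n * m ->
  a * n + b * m = c * n + d * m -> a = c /\ b = d.
Proof.
move=> lt e.
have bn : b < n by rewrite -(ltn_pmul2r m_gt0); lia.
have dn : d < n by rewrite -(ltn_pmul2r m_gt0); lia.
have [/leq_exD[k kE]|/leq_exD[k kE]|eq_bd] := ltngtP b d; last first.
- by split=> //; apply/eqP; rewrite -(eqn_pmul2r n_gt0); subst; lia.
- have [p pE] : exists p, c = a + p.
    by apply: leq_exD; rewrite -(leq_pmul2r n_gt0); subst; lia.
  subst; have e' : p * n = k.+1 * m by lia.
  have p0 : 0 < p by rewrite lt0n; apply/eqP => p0; subst; lia.
  by have := leq_of_muln_eq p0 e'; lia.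
- have [p pE] : exists p, a = c + p.
    by apply: leq_exD; rewrite -(leq_pmul2r n_gt0); subst; lia.
  subst; have e' : p * n = k.+1 * m by lia.
  have p0 : 0 < p by rewrite lt0n; apply/eqP => p0; subst; lia.
  by have := leq_of_muln_eq p0 e'; lia.
Qed.

Lemma semigroup2_gap v : ~ G v -> exists2 g, G g & v + n + m + g = n * m.
Proof.
move=> nGv; pose w := chinese n m v 0.
have wn : w = v %[mod n] by apply: chinese_modl.
have /dvdnP[q wq] : m %| w by rewrite /dvdn /w (chinese_modr co_nm) mod0n.
have [b bn bm] : exists2 b, b < n & b * m = v %[mod n].
  by exists (q %% n); rewrite ?ltn_pmod // -wn wq modnMml.
have [d dE] := leq_exD bn.
have [le_bv|lt_vb] := leqP (b * m) v.
  exfalso; apply: nGv; exists ((v - b * m) %/ n), b.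
  by rewrite divnK ?subnK // -eqn_mod_dvd //; apply/eqP.
have /dvdnP[k hk] : n %| b * m - v by rewrite -eqn_mod_dvd ?(ltnW lt_vb) //; apply/eqP.
case: k hk => [|k] hk; first lia.
exists (k * n + d * m); first by exists k, d.
have nmE : n * m = (b.+1 + d) * m by rewrite -dE.
by lia.
Qed.

Lemma semigroup2_large v : n * m < v + n + m -> G v.
Proof. by move=> h; apply: contrapT => /semigroup2_gap[g _]; lia. Qed.

End Semigroup.

Lemma first_genD n m l i u g : first_gen l (semigroup2 n m) i u ->
  semigroup2 n m g -> first_gen l (semigroup2 n m) i (u + g).
Proof.
move=> [k [h [ki Gh ->]]] Gg; exists k, (h + g); split=> //; last by rewrite addnA.
exact: semigroup2D.
Qed.

Lemma first_gen_le l G i j u : i <= j -> first_gen l G i u -> first_gen l G j u.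
Proof. by move=> ij [k [h [ki Gh ->]]]; exists k, h; split=> //; apply: leq_trans ij. Qed.

Lemma first_genS l G i u : first_gen l G i.+1 u ->
  first_gen l G i u \/ exists2 g, G g & u = l i + g.
Proof.
move=> [k [h [ki Gh ->]]]; move: ki; rewrite ltnS leq_eqVlt => /orP[/eqP ->|ki].
  by right; exists h.
by left; exists k, h.
Qed.

Definition axis_of (n m : nat) (l : nat -> nat) (p i : nat) : nat :=
  least [set v | first_gen l (semigroup2 n m) i v /\
                 exists q : nat, 1 <= q /\ v = l i + p * q].

Section Staircase.
Variables (n m : nat) (l : nat -> nat) (K : nat).
Hypotheses (n_ge2 : 1 < n) (n_lt_m : n < m) (co_nm : coprime n m).
Local Notation G := (semigroup2 n m).
Local Notation D := (first_gen l G).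
Hypotheses (l0 : l 0 = n) (l1 : l 1 = m).
Hypothesis l_mono : forall i j, i < j -> j < K -> l i < l j.
Hypothesis l_new : forall i, i < K -> ~ D i (l i).

Local Notation Un i := (axis_of n m l n i).
Local Notation Um i := (axis_of n m l m i).
Local Notation low i := (minn (Un i) (Um i)).
Local Notation high i := (maxn (Un i) (Um i)).

Let n_gt0 : 0 < n. Proof. lia. Qed.
Let m_gt0 : 0 < m. Proof. lia. Qed.

Let leq_addnm : n + m <= n * m.
Proof.
have [k ->] := leq_exD n_ge2; have [p ->] := leq_exD n_lt_m.
by have [q ->] := leq_exD n_ge2; lia.
Qed.

Lemma gen_addnm i : 0 < i -> D i (l i + n * m).
Proof.
move=> i0; exists 0, (l i + n * m - n); split=> //; last by rewrite l0; lia.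
by apply: semigroup2_large => //; lia.
Qed.

Lemma axisP p i : (p = n \/ p = m) -> 0 < i < K ->
  exists q, [/\ p * q.+1 <= n * m, axis_of n m l p i = l i + p * q.+1,
    D i (l i + p * q.+1) & forall r, r <= q -> ~ D i (l i + p * r)].
Proof.
move=> pnm /andP[i0 iK].
pose A := [set v | D i v /\ exists q : nat, 1 <= q /\ v = l i + p * q].
have Anm : A (l i + n * m).
  split; first exact: gen_addnm.
  by case: pnm => ->; [exists m | exists n]; split; rewrite ?[n * _]mulnC; lia.
have A0 : A !=set0 by exists (l i + n * m).
have [] := leastP A0; rewrite -/(axis_of n m l p i) => -[Dq [[|q] [q0 eq]] minq] //.
exists q; split=> //.
- by have := minq _ Anm; rewrite eq leq_add2l.
- by rewrite -eq.
- move=> [|r] rq Dr; first by apply: (l_new iK); rewrite muln0 addn0 in Dr.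
  have Ar : A (l i + p * r.+1) by split=> //; exists r.+1.
  have := minq _ Ar; rewrite eq leq_add2l leq_pmul2l; last by case: pnm => ->.
  by rewrite ltnNge rq.
Qed.

Lemma gen_meet i v : 0 < i < K -> D i v -> (exists2 g, G g & v = l i + g) ->
  exists2 g, G g & v = Un i + g \/ v = Um i + g.
Proof.
move=> iK [k [h [ki [a' [b' ->]] vk]]] [g [a [b ->]] vi].
have /andP[i0 iK'] := iK.
have lk : l k < l i by apply: l_mono.
have [q [_ eq _ nq]] := axisP (or_introl (erefl n)) iK.
have [r [_ er _ nr]] := axisP (or_intror (erefl m)) iK.
have [/leq_exD[c cE]|/leq_exD[c cE]] := leqP a a';
  have [/leq_exD[d dE]|/leq_exD[d dE]] := leqP b b'.
- subst a' b'; exfalso; apply: (l_new iK'); exists k, (c * n + d * m).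
  by split=> //; [exists c, d | lia].
- subst a' b; have /leq_exD[e eE] : r.+1 <= d.+1.
    rewrite ltnNge; apply/negP => /nr; apply.
    by exists k, (c * n); split=> //; [exact: semigroup2_mull | lia].
  exists (a * n + (b' + e) * m); first by exists a, (b' + e).
  have {}eE : d = r + e by lia.
  by right; rewrite er; subst d; lia.
- subst a b'; have /leq_exD[e eE] : q.+1 <= c.+1.
    rewrite ltnNge; apply/negP => /nq; apply.
    by exists k, (d * m); split=> //; [exact: semigroup2_mulr | lia].
  exists ((a' + e) * n + b * m); first by exists (a' + e), b.
  have {}eE : c = q + e by lia.
  by left; rewrite eq; subst c; lia.
- by subst a b; exfalso; lia.
Qed.

Lemma axis_gt p i : (p = n \/ p = m) -> 0 < i < K -> l i < axis_of n m l p i.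
Proof.
by move=> pnm iK; have [q [_ -> _ _]] := axisP pnm iK; case: pnm => ->; lia.
Qed.

Lemma axis_pred_notin p i v : (p = n \/ p = m) -> 0 < i < K ->
  v + n + m = axis_of n m l p i -> ~ D i.+1 v.
Proof.
move=> pnm iK ev; have [q [qnm eq _ nq]] := axisP pnm iK.
move=> /first_genS[Dv|[g [a [b ->]] vg]].
  apply: (nq q) => //; case: pnm => pE; subst p.
  - have -> : l i + n * q = v + 1 * m by lia.
    by apply: first_genD => //; exact: semigroup2_mulr.
  - have -> : l i + m * q = v + 1 * n by lia.
    by apply: first_genD => //; exact: semigroup2_mull.
case: pnm => pE; subst p.
- have [d dE] : exists d, q = a + d.
    by apply: leq_exD; rewrite -(leq_pmul2r n_gt0); lia.
  have e : d * n = b.+1 * m by subst q; lia.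
  have := leq_of_muln_eqr m_gt0 co_nm (ltn0Sn _) e.
  by rewrite -(leq_pmul2r n_gt0); subst q; lia.
- have [d dE] : exists d, q = b + d.
    by apply: leq_exD; rewrite -(leq_pmul2r m_gt0); lia.
  have e : a.+1 * n = d * m by subst q; lia.
  have := leq_of_muln_eq n_gt0 co_nm (ltn0Sn _) e.
  by rewrite -(leq_pmul2r m_gt0); subst q; lia.
Qed.

Definition corners i := forall v, ~ D i.+1 v ->
  v + n + m <= low i \/ exists2 g, G g & v + n + m + g = high i.

Lemma corner_split i a b : 0 < i -> i.+1 < K -> corners i -> low i < l i.+1 ->
  l i.+1 + n + m + (a * n + b * m) = high i ->
  Un i.+1 = l i.+1 + n * a.+1 /\ Um i.+1 = l i.+1 + m * b.+1.
Proof.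
move=> i0 iK cor low_lt hl.
have iK1 : 0 < i < K by rewrite i0 ltnW.
have iK2 : 0 < i.+1 < K by [].
have [qn [qnm en dn nn]] := axisP (or_introl (erefl n)) iK2.
have [qm [qmm em dm nm]] := axisP (or_intror (erefl m)) iK2.
have high_lt : high i < l i.+1 + n * m.
  have lti : l i < l i.+1 by apply: l_mono.
  have [q [qlt -> _ _]] := axisP (or_introl (erefl n)) iK1.
  by have [r [rlt -> _ _]] := axisP (or_intror (erefl m)) iK1; lia.
have notin : ~ D i.+1 (l i.+1 + (a * n + b * m)).
  have [e|e] : high i = Un i \/ high i = Um i by lia.
  + by apply: (@axis_pred_notin n) => //; [left | lia].
  + by apply: (@axis_pred_notin m) => //; [right | lia].
have Da : D i.+1 (l i.+1 + n * a.+1).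
  apply: contrapT => /cor[|[g [c [d ->]] e]]; first lia.
  have [p pE] : exists p, b = d + p.
    by apply: leq_exD; rewrite -(leq_pmul2r m_gt0); lia.
  have e' : c.+1 * n = p * m by subst b; lia.
  have := leq_of_muln_eq n_gt0 co_nm (ltn0Sn _) e'.
  by rewrite -(leq_pmul2r m_gt0); subst b; lia.
have Db : D i.+1 (l i.+1 + m * b.+1).
  apply: contrapT => /cor[|[g [c [d ->]] e]]; first lia.
  have [p pE] : exists p, a = c + p.
    by apply: leq_exD; rewrite -(leq_pmul2r n_gt0); lia.
  have e' : p * n = d.+1 * m by subst a; lia.
  have := leq_of_muln_eqr m_gt0 co_nm (ltn0Sn _) e'.
  by rewrite -(leq_pmul2r n_gt0); subst a; lia.
have qna : qn = a.
  apply/eqP; rewrite eqn_leq; apply/andP; split.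
    by rewrite leqNgt; apply/negP => /nn.
  rewrite leqNgt; apply/negP => /leq_exD[c cE]; apply: notin.
  have -> : l i.+1 + (a * n + b * m) = l i.+1 + n * qn.+1 + (c * n + b * m).
    by subst a; lia.
  by apply: first_genD => //; exists c, b.
have qmb : qm = b.
  apply/eqP; rewrite eqn_leq; apply/andP; split.
    by rewrite leqNgt; apply/negP => /nm.
  rewrite leqNgt; apply/negP => /leq_exD[c cE]; apply: notin.
  have -> : l i.+1 + (a * n + b * m) = l i.+1 + m * qm.+1 + (a * n + c * m).
    by subst b; lia.
  by apply: first_genD => //; exists a, c.
by rewrite en em qna qmb.
Qed.

Lemma corners1 : 1 < K -> corners 1.
Proof.
move=> K1 v nDv.
have iK : 0 < 1 < K by [].
have D1n : D 1 (l 1 + n * 1).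
  by exists 0, m; split=> //; [exists 0, 1; lia | rewrite l0 l1; lia].
have [qn [qnm en dn nn]] := axisP (or_introl (erefl n)) iK.
have qn1 : qn = 0 by case: qn nn {qnm en dn} => // q /(_ 1 isT).
have [qm [qmm em [k [g [k1 [a [b ->]] e]]] nm]] := axisP (or_intror (erefl m)) iK.
have kE : k = 0 by case: k k1 {e}.
rewrite kE l0 l1 in e.
have [d dE] : exists d, qm.+2 = b + d.
  by apply: leq_exD; rewrite -(leq_pmul2r m_gt0); lia.
have e' : a.+1 * n = d * m.
  by have : qm.+2 * m = (b + d) * m; [rewrite dE | lia].
have nd := leq_of_muln_eq n_gt0 co_nm (ltn0Sn _) e'.
have [f fE] := leq_exD nd.
have Umnm : Um 1 = n * m.
  have h : qm.+2 * m = (b + (n + f)) * m by rewrite dE fE.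
  have qn' : qm.+2 <= n.
    rewrite ltnNge; apply/negP => /leq_exD[p pE].
    have [p' p'E] := leq_exD n_ge2.
    apply: (nm p'.+1); first lia.
    exists 0, (m.-1 * n); split=> //; first exact: semigroup2_mull.
    by rewrite l0 l1 -mulSn -mulnS prednK // p'E.
  have := leq_mul2r m qm.+2 n; rewrite qn' orbT em l1; lia.
have Unnm : Un 1 = n + m by rewrite en qn1 l1; lia.
have hi : high 1 = n * m by rewrite Umnm Unnm; lia.
case: (posnP v) => [-> |v0]; first by left; rewrite Umnm Unnm; lia.
right; rewrite hi; apply: (semigroup2_gap n_gt0 m_gt0 co_nm) => -[a' [b' ev]].
apply: nDv; case: a' ev => [|a'] ev; last first.
  exists 0, (a' * n + b' * m); split=> //; first by exists a', b'.
  by rewrite l0 ev; lia.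
case: b' ev => [|b'] ev; first by lia.
exists 1, (b' * m); split=> //; first exact: semigroup2_mulr.
by rewrite l1 ev; lia.
Qed.

Lemma corners_gen i : 0 < i -> i.+1 < K -> corners i -> low i < l i.+1 ->
  exists2 g, G g & l i.+1 + n + m + g = high i.
Proof. by move=> i0 iK cor lt; case: (cor _ (l_new iK)) => // le; exfalso; lia. Qed.

Lemma cornersS i : 0 < i -> i.+1 < K -> corners i -> low i < l i.+1 ->
  corners i.+1.
Proof.
move=> i0 iK cor lt v nDv.
have iK2 : 0 < i.+1 < K by [].
have [g [a [b ->]] hl] := corners_gen i0 iK cor lt.
have [en em] := corner_split i0 iK cor lt hl.
have gtm := axis_gt (or_intror (erefl m)) iK2.
have gtn := axis_gt (or_introl (erefl n)) iK2.
have nDv' : ~ D i.+1 v by move=> /(first_gen_le (leqnSn _)).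
case: (cor _ nDv') => [le|[h [c [d ->]] hv]]; first by left; lia.
have on_axis p g' : (p = n \/ p = m) -> G g' ->
    v + n + m + g' = axis_of n m l p i.+1 ->
    v + n + m <= low i.+1 \/ exists2 g, G g & v + n + m + g = high i.+1.
  move=> pnm Gg' e.
  have [hi|lo] : axis_of n m l p i.+1 = high i.+1 \/ axis_of n m l p i.+1 = low i.+1.
    by case: pnm => ->; lia.
  - by right; exists g'; rewrite ?e.
  - by left; lia.
have [/leq_exD[f fE]|/leq_exD[f fE]] := leqP c a; last first.
  apply: (@on_axis m (f * n + d * m)); [by right | by exists f, d |].
  by rewrite em; subst c; lia.
have [/leq_exD[k kE]|/leq_exD[k kE]] := leqP d b; last first.
  apply: (@on_axis n (c * n + k * m)); [by left | by exists c, k |].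
  by rewrite en; subst d; lia.
exfalso; apply: nDv; exists i.+1, (f * n + k * m); split=> //.
  by exists f, k.
by subst a b; lia.
Qed.

Lemma high_decr i : 0 < i -> i.+1 < K -> corners i -> low i < l i.+1 ->
  high i.+1 < high i.
Proof.
move=> i0 iK cor lt.
have [g [a [b ->]] hl] := corners_gen i0 iK cor lt.
by have [-> ->] := corner_split i0 iK cor lt hl; lia.
Qed.

Lemma corners_conductor i : 0 < i < K -> corners i ->
  conductor (D i.+1) + n + m = high i + 1.
Proof.
move=> iK cor.
have gtn := axis_gt (or_introl (erefl n)) iK.
have gtm := axis_gt (or_intror (erefl m)) iK.
have lei : m <= l i.
  case: i iK {cor gtn gtm} => // -[|i] /andP[_ iK]; first by rewrite l1.
  by rewrite -l1 ltnW // l_mono.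
have gem : l i + m <= Um i.
  by have [q [_ -> _ _]] := axisP (or_intror (erefl m)) iK; lia.
have inD k : high i < k + n + m -> D i.+1 k.
  by move=> lt; apply: contrapT => /cor[|[g _]]; lia.
set A := [set c | forall k, c <= k -> D i.+1 k].
have Ah : A (high i + 1 - n - m) by move=> k le; apply: inD; lia.
have A0 : A !=set0 by exists (high i + 1 - n - m).
have [] := leastP A0; rewrite -/(conductor (D i.+1)) => Ac /(_ _ Ah) cle.
suff : ~ (conductor (D i.+1) <= high i - n - m) by lia.
move=> /Ac; have [e|e] : high i = Un i \/ high i = Um i by lia.
+ by apply: (@axis_pred_notin n) => //; [left | lia].
+ by apply: (@axis_pred_notin m) => //; [right | lia].
Qed.

End Staircase.

(** * Standard bases *)

Import GRing.Theory.

Local Open Scope ring_scope.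

Section Order.
Variable F : fieldType.
Implicit Types (f g : {poly F}) (p q : nat).

Definition order_ge p f := forall i, (i < p)%N -> f`_i = 0.

Definition order_eq p f := order_ge p f /\ f`_p != 0.

Lemma order_geP p f : order_ge p f <-> exists g, f = 'X^p * g.
Proof.
split=> [fp|[g ->] i ip]; last by rewrite coefXnM ip.
exists (drop_poly p f); rewrite -[LHS](poly_take_drop p) mulrC.
suff -> : take_poly p f = 0 by rewrite add0r.
by apply/polyP => i; rewrite coef_take_poly coef0; case: ifP => // /fp.
Qed.

Lemma order_ge0 f : order_ge 0 f. Proof. by []. Qed.

Lemma order_ge_zero p : order_ge p 0. Proof. by move=> i _; rewrite coef0. Qed.

Lemma order_geW p q f : (p <= q)%N -> order_ge q f -> order_ge p f.
Proof. by move=> pq fq i ip; apply/fq/(leq_trans ip). Qed.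

Lemma order_geD p f g : order_ge p f -> order_ge p g -> order_ge p (f + g).
Proof. by move=> fp gp i ip; rewrite coefD fp ?gp ?addr0. Qed.

Lemma order_geB p f g : order_ge p f -> order_ge p g -> order_ge p (f - g).
Proof. by move=> fp gp i ip; rewrite coefB fp ?gp ?subr0. Qed.

Lemma order_geZ p (a : F) f : order_ge p f -> order_ge p (a *: f).
Proof. by move=> fp i ip; rewrite coefZ fp ?mulr0. Qed.

Lemma order_geM p q f g : order_ge p f -> order_ge q g -> order_ge (p + q) (f * g).
Proof.
move=> /order_geP[f' ->] /order_geP[g' ->]; apply/order_geP.
by exists (f' * g'); rewrite exprD; ring.
Qed.

Lemma order_geMr p f g : order_ge p g -> order_ge p (f * g).
Proof. by move=> gp; apply: (@order_geM 0). Qed.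

Lemma order_ge_sum p (I : Type) (r : seq I) (P : pred I) (f : I -> {poly F}) :
  (forall i, P i -> order_ge p (f i)) -> order_ge p (\sum_(i <- r | P i) f i).
Proof.
by move=> fp; apply: big_ind => //; [exact: order_ge_zero | exact: order_geD].
Qed.

Lemma order_geS p f : order_ge p f -> f`_p = 0 -> order_ge p.+1 f.
Proof. by move=> fp f0 i; rewrite ltnS leq_eqVlt => /orP[/eqP ->|/fp]. Qed.

Lemma coef_orderM p q f g : order_ge p f -> order_ge q g ->
  (f * g)`_(p + q) = f`_p * g`_q.
Proof.
move=> /order_geP[f' ->] /order_geP[g' ->].
have -> : 'X^p * f' * ('X^q * g') = 'X^(p + q) * (f' * g') by rewrite exprD; ring.
by rewrite !coefXnM !ltnn !subnn coefM big_ord1 subnn.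
Qed.

Lemma order_eqM p q f g : order_eq p f -> order_eq q g -> order_eq (p + q) (f * g).
Proof.
move=> [fp f0] [gq g0]; split; first exact: order_geM.
by rewrite coef_orderM // mulf_neq0.
Qed.

Lemma order_eqX p k f : order_eq p f -> order_eq (k * p) (f ^+ k).
Proof.
move=> fp; elim: k => [|k IH]; first by split=> //; rewrite expr0 coef1 oner_neq0.
by rewrite mulSn exprS; apply: order_eqM.
Qed.

Lemma order_eqZ p (a : F) f : a != 0 -> order_eq p f -> order_eq p (a *: f).
Proof.
by move=> a0 [fp f0]; split; [exact: order_geZ | rewrite coefZ mulf_neq0].
Qed.

Lemma order_ge_eq p q f : order_ge p f -> order_eq q f -> (p <= q)%N.
Proof. by move=> fp [_]; rewrite leqNgt; apply: contraNN => /fp ->. Qed.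

Lemma order_eq_inj p q f : order_eq p f -> order_eq q f -> p = q.
Proof.
move=> [fp f0] [fq g0]; apply/eqP; rewrite eqn_leq.
by rewrite (order_ge_eq fp) // (order_ge_eq fq).
Qed.

Lemma order_eq_neq0 p f : order_eq p f -> f != 0.
Proof. by move=> [_]; apply: contraNneq => ->; rewrite coef0. Qed.

Lemma order_eq_ex f : f != 0 -> exists p, order_eq p f.
Proof.
move=> f0; have exf : exists p, f`_p != 0.
  by exists (size f).-1; rewrite -lead_coefE lead_coef_eq0.
exists (ex_minn exf); case: ex_minnP => p fp minp; split=> // i ip.
by apply: contraTeq ip => /minp; rewrite leqNgt.
Qed.

Lemma order_eqP p f : order_ge p f -> f`_p = 0 \/ order_eq p f.
Proof. by move=> fp; have [|] := eqVneq f`_p 0; [left | right]. Qed.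

Lemma order_eq_quot p q f g : order_eq q g -> order_eq p (f * g) ->
  exists2 r, order_eq r f & p = (r + q)%N.
Proof.
move=> gq fgp.
have [|r fr] := @order_eq_ex f.
  by apply: contraTneq (order_eq_neq0 fgp) => ->; rewrite mul0r eqxx.
by exists r => //; apply: order_eq_inj fgp (order_eqM fr gq).
Qed.

Lemma order_eq_subl p f g : order_eq p f -> order_ge p.+1 g -> order_eq p (f - g).
Proof.
move=> [fp f0] gp; split; first by apply: order_geB => //; apply: order_geW gp.
by rewrite coefB [g`_p]gp ?subr0.
Qed.

End Order.

Section Representation.
Variables (F : fieldType) (O : {poly F} -> Prop).
Hypotheses (O_C : forall c, O c%:P) (OD : forall f g, O f -> O g -> O (f + g))
  (OM : forall f g, O f -> O g -> O (f * g)).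
Implicit Types (w : nat -> {poly F}) (f g h : {poly F}) (i j p q : nat).

Definition repr_ge w i p f := exists c : nat -> {poly F},
  [/\ forall k, O (c k), forall k, (k < i)%N -> order_ge p (c k * w k) &
      f = \sum_(k < i) c k * w k].

Lemma O0 : O 0. Proof. by rewrite -[0]/(0%:P). Qed.

Lemma OZ a f : O f -> O (a *: f).
Proof. by move=> Of; rewrite -mul_polyC; apply: OM. Qed.

Lemma OB f g : O f -> O g -> O (f - g).
Proof. by move=> Of Og; rewrite -[- g]scaleN1r; apply/OD/OZ. Qed.

Lemma repr_geD w i p f g :
  repr_ge w i p f -> repr_ge w i p g -> repr_ge w i p (f + g).
Proof.
move=> [c [Oc cp ->]] [d [Od dp ->]]; exists (fun k => c k + d k); split.
- by move=> k; apply: OD.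
- by move=> k ki; rewrite mulrDl; apply: order_geD; [exact: cp | exact: dp].
- by rewrite -big_split; apply: eq_bigr => k _; rewrite mulrDl.
Qed.

Lemma repr_geM w i p q f h : O h -> order_ge q h ->
  repr_ge w i p f -> repr_ge w i (q + p) (h * f).
Proof.
move=> Oh hq [c [Oc cp ->]]; exists (fun k => h * c k); split.
- by move=> k; apply: OM.
- by move=> k ki; rewrite -mulrA; apply: order_geM => //; apply: cp.
- by rewrite mulr_sumr; apply: eq_bigr => k _; rewrite mulrA.
Qed.

Lemma repr_geZ w i p a f : repr_ge w i p f -> repr_ge w i p (a *: f).
Proof. by move=> fp; rewrite -mul_polyC; apply: (@repr_geM _ _ _ 0). Qed.

Lemma repr_ge_order w i p f : repr_ge w i p f -> order_ge p f.
Proof. by move=> [c [_ cp ->]]; apply: order_ge_sum => k _; apply: cp. Qed.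

Lemma repr_geW w i p q f : (p <= q)%N -> repr_ge w i q f -> repr_ge w i p f.
Proof.
move=> pq [c [Oc cq ->]]; exists c; split=> // k ki.
by apply: order_geW pq _; apply: cq.
Qed.

Lemma repr_ge0 w i p : repr_ge w i p 0.
Proof.
exists (fun=> 0); split=> [_|k _|]; first exact: O0.
  by rewrite mul0r; apply: order_ge_zero.
by rewrite big1 // => k _; rewrite mul0r.
Qed.

Lemma repr_ge_single w i p k c : (k < i)%N -> O c -> order_ge p (c * w k) ->
  repr_ge w i p (c * w k).
Proof.
move=> ki Oc cp; exists (fun j => if j == k then c else 0); split.
- by move=> j; case: ifP => // _; apply: O0.
- by move=> j _; case: eqP => [->|_] //; rewrite mul0r; apply: order_ge_zero.
- rewrite (bigD1 (Ordinal ki)) //= eqxx big1 ?addr0 // => j /eqP jk.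
  by rewrite ifF ?mul0r //; apply/eqP => e; apply/jk/val_inj.
Qed.

Lemma repr_geS w i p f : repr_ge w i p f -> repr_ge w i.+1 p f.
Proof.
move=> [c [Oc cp ->]]; exists (fun k => if k == i then 0 else c k); split.
- by move=> k; case: ifP => // _; apply: O0.
- move=> k; rewrite ltnS leq_eqVlt; case: eqP => [_ _|_ /= /cp //].
  by rewrite mul0r; apply: order_ge_zero.
- rewrite big_ord_recr /= eqxx mul0r addr0; apply: eq_bigr => k _.
  by rewrite ltn_eqF.
Qed.

Lemma eq_repr_ge w w' i p f : (forall k, (k < i)%N -> w k = w' k) ->
  repr_ge w i p f -> repr_ge w' i p f.
Proof.
move=> ww' [c [Oc cp ->]]; exists c; split=> // [k ki|].
  by rewrite -ww' //; apply: cp.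
by apply: eq_bigr => k _; rewrite ww'.
Qed.

End Representation.

Section Delorme.
Variables (F : fieldType) (O : {poly F} -> Prop).
Hypotheses (O_C : forall c, O c%:P) (OD : forall f g, O f -> O g -> O (f + g))
  (OM : forall f g, O f -> O g -> O (f * g)).
Variables (n m : nat).
Hypotheses (n_ge2 : (1 < n)%N) (n_lt_m : (n < m)%N) (co_nm : coprime n m).
Local Notation G := (semigroup2 n m).
Hypotheses (O_order : forall f v, O f -> order_eq v f -> G v)
  (O_elt : forall v, G v -> exists2 f, O f & order_eq v f).
Variables (e0 e1 : {poly F}).
Hypotheses (ord_e0 : order_eq n e0) (ord_e1 : order_eq m e1).

Definition module2 f := exists a b, [/\ O a, O b & f = a * e0 + b * e1].

Variables (l : nat -> nat) (K : nat).
Local Notation D := (first_gen l G).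
Hypotheses (l0 : l 0 = n) (l1 : l 1 = m).
Hypothesis l_mono : forall i j, (i < j)%N -> (j < K)%N -> (l i < l j)%N.
Hypothesis l_new : forall i, (i < K)%N -> ~ D i (l i).
Hypothesis l_basis : forall v, D K v <-> exists2 f, module2 f & order_eq v f.

Local Notation Un i := (axis_of n m l n i).
Local Notation Um i := (axis_of n m l m i).
Local Notation low i := (minn (Un i) (Um i)).
Local Notation high i := (maxn (Un i) (Um i)).
Local Notation repr_ge := (repr_ge O).

Lemma value_lt_gen i f v : (i < K)%N -> module2 f -> order_eq v f ->
  (v < l i)%N -> D i v.
Proof.
move=> iK Mf fv vi; have /l_basis[k [g [kK Gg vE]]] : exists2 f, module2 f & order_eq v f.
  by exists f.
exists k, g; split=> //; rewrite ltnNge; apply/negP; rewrite leq_eqVlt.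
case/orP=> [/eqP e|/l_mono/(_ kK)]; last lia.
by subst k; lia.
Qed.

Lemma basis_elt i : (i < K)%N -> exists2 f, module2 f & order_eq (l i) f.
Proof.
by move=> iK; apply/l_basis; exists i, 0%N; split=> //; [exists 0%N, 0%N | rewrite addn0].
Qed.

Lemma repr_order_gen w i p f : (forall k, (k < i)%N -> order_eq (l k) (w k)) ->
  repr_ge w i p f -> f`_p != 0 -> D i p.
Proof.
move=> wl [c [Oc cp ->]]; rewrite coef_sum => nz.
have [k ck] : exists k : 'I_i, (c k * w k)`_p != 0.
  apply: contrapT => /forallNP h; move/negP: nz; apply; apply/eqP/big1 => k _.
  by apply/eqP/negPn/negP/h.
have [r cr ->] := order_eq_quot (wl k (ltn_ord k)) (conj (cp k (ltn_ord k)) ck).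
by exists k, r; split=> //; [exact: O_order cr | rewrite addnC].
Qed.

Section Step.
Variables (w : nat -> {poly F}) (i : nat).
Hypotheses (w0 : w 0 = e0) (w1 : w 1 = e1).
Hypotheses (i_gt0 : (0 < i)%N) (iK : (i < K)%N).
Hypothesis w_ord : forall k, (k <= i)%N -> order_eq (l k) (w k).
Hypothesis cor : corners n m l i.

Definition resolves w i := forall p f, (p < high i)%N ->
  repr_ge w i p f -> order_ge p.+1 f -> repr_ge w i.+1 p.+1 f.

Hypothesis w_res : resolves w i.

Let iK0 : (0 < i < K)%N. Proof. by rewrite i_gt0. Qed.

Definition S_poly (g : nat -> {poly F}) := \sum_(k < i.+1) g k * w k.

Definition S_pair (g : nat -> {poly F}) :=
  [/\ forall k, O (g k), forall k, (k < i.+1)%N -> order_ge (low i) (g k * w k),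
      order_eq (low i) (g i * w i) & order_ge (low i).+1 (S_poly g)].

Lemma low_gen : D i (low i) /\ exists2 h, G h & low i = (l i + h)%N.
Proof.
have [q [_ eq dq _]] := axisP n_ge2 n_lt_m co_nm l0 l1 l_new (or_introl (erefl n)) iK0.
have [r [_ er dr _]] := axisP n_ge2 n_lt_m co_nm l0 l1 l_new (or_intror (erefl m)) iK0.
have [->|->] : low i = Un i \/ low i = Um i by lia.
- split; first by rewrite eq.
  by exists (q.+1 * n)%N; [exact: semigroup2_mull | rewrite eq mulnC].
- split; first by rewrite er.
  by exists (r.+1 * m)%N; [exact: semigroup2_mulr | rewrite er mulnC].
Qed.

Lemma S_pair_ex : exists g, S_pair g.
Proof.
have [[k [h [ki /O_elt[b Ob bh] lk]]] [h' /O_elt[a Oa ah] li]] := low_gen.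
have wi := w_ord (leqnn i); have wk := w_ord (ltnW ki).
have awi : order_eq (low i) (a * w i) by rewrite li addnC; apply: order_eqM.
have bwk : order_eq (low i) (b * w k) by rewrite lk addnC; apply: order_eqM.
pose r := (a * w i)`_(low i) / (b * w k)`_(low i).
have Ob' : O (- r *: b) by apply: OZ.
have bwk' : order_ge (low i) (- r *: b * w k).
  by rewrite -scalerAl; apply: order_geZ; case: bwk.
exists (fun j => if j == i then a else if j == k then - r *: b else 0).
have SE : S_poly (fun j => if j == i then a else if j == k then - r *: b else 0) =
    a * w i - r *: (b * w k).
  rewrite /S_poly big_ord_recr /= eqxx addrC; congr (_ + _).
  rewrite (bigD1 (Ordinal ki)) //= eqxx ltn_eqF // big1 ?addr0.
    by rewrite -scalerAl scaleNr.
  move=> j /eqP jk; rewrite ltn_eqF // ifF ?mul0r //.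
  by apply/eqP => e; apply/jk/val_inj.
split.
- by move=> j; do 2?case: ifP => // _; exact: O0.
- move=> j _; case: eqP => [->|_]; first by case: awi.
  by case: eqP => [->|_] //; rewrite mul0r; apply: order_ge_zero.
- by rewrite eqxx.
- rewrite SE; apply: order_geS.
    by apply: order_geB; [case: awi | apply: order_geZ; case: bwk].
  by rewrite coefB coefZ /r divfK ?subrr //; case: bwk.
Qed.

Lemma repr_last p c : (p < high i)%N -> (forall k, O (c k)) ->
  (forall k, (k < i.+1)%N -> order_ge p (c k * w k)) ->
  order_ge p.+1 (c i * w i) -> order_ge p.+1 (S_poly c) ->
  repr_ge w i.+1 p.+1 (S_poly c).
Proof.
move=> ph Oc cp ci; rewrite /S_poly big_ord_recr /= => sp.
apply: repr_geD => //; last exact: repr_ge_single.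
apply: w_res => //.
  by exists c; split=> // k ki; apply/cp/ltnW.
rewrite -[X in order_ge _ X](addrK (c i * w i)).
exact: order_geB.
Qed.

Lemma reduce_by_S g p f : S_pair g -> (p < high i)%N ->
  repr_ge w i.+1 p f -> order_ge p.+1 f ->
  exists c, [/\ O c, (p < low i)%N -> c = 0, order_ge (p - low i) c &
    repr_ge w i.+1 p.+1 (f - c * S_poly g)].
Proof.
move=> [Og gl gi gS] ph [c [Oc cp fE]] fp.
have [ci0|ciN] := order_eqP (cp i (ltnSn i)).
  exists 0; split=> //; [exact: O0 | exact: order_ge_zero |].
  rewrite mul0r subr0 fE; apply: repr_last => //; last by rewrite /S_poly -fE.
  by apply: order_geS => //; apply: cp.
have wi := w_ord (leqnn i).
have [r cr pE] := order_eq_quot wi ciN.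
have Dp : D i p.
  apply: (@repr_order_gen w i p (\sum_(k < i) c k * w k)).
  - by move=> k ki; apply/w_ord/ltnW.
  - by exists c; split=> // k ki; apply/cp/ltnW.
  have /eqP : f`_p = 0 by apply: fp.
  rewrite fE big_ord_recr /= coefD addr_eq0 => /eqP ->.
  by rewrite oppr_eq0; case: ciN.
have [|h Gh hp] := gen_meet n_ge2 n_lt_m co_nm l0 l1 l_mono l_new iK0 Dp.
  by exists r; [exact: O_order cr | rewrite addnC].
have {hp}pE' : p = (h + low i)%N by lia.
have [d Od dh] := O_elt Gh.
have dgw : order_eq p (d * (g i * w i)) by rewrite pE'; apply: order_eqM.
pose k0 := (c i * w i)`_p / (d * (g i * w i))`_p.
have ord_d : order_ge (p - low i) (k0 *: d).
  by rewrite pE' addnK; apply: order_geZ; case: dh.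
have Okd : O (k0 *: d) by apply: OZ.
have SE : f - (k0 *: d) * S_poly g = S_poly (fun k => c k - (k0 *: d) * g k).
  rewrite fE /S_poly mulr_sumr -sumrB; apply: eq_bigr => k _.
  by rewrite mulrBl mulrA.
have p_low : (p - low i + low i = p)%N by lia.
exists (k0 *: d); split=> //; first by lia.
rewrite SE; apply: repr_last => //.
- by move=> k; apply: OB => //; apply: OM.
- move=> k ki; rewrite mulrBl -mulrA; apply: order_geB; first exact: cp.
  by rewrite -p_low; apply: order_geM => //; apply: gl.
- rewrite mulrBl -mulrA; apply: order_geS.
    apply: order_geB; first exact: cp.
    by rewrite -p_low; apply: order_geM => //; apply: gl.
  by rewrite coefB -scalerAl coefZ /k0 divfK ?subrr //; case: dgw.
- rewrite -SE; apply: order_geB => //.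
  by rewrite -p_low -addnS; apply: order_geM.
Qed.

Lemma module2_repr f : module2 f -> repr_ge w i.+1 0 f.
Proof.
move=> [a [b [Oa Ob ->]]]; apply: repr_geD => //.
  by rewrite -w0; apply: repr_ge_single.
by rewrite -w1; apply: repr_ge_single => //; rewrite ltnS.
Qed.

Lemma O_submodule (r : nat) (c v : nat -> {poly F}) : (forall k, O (c k)) ->
  (forall k, (k < r)%N -> module2 (v k)) -> module2 (\sum_(k < r) c k * v k).
Proof.
move=> Oc; elim: r => [|r IH] Mv.
  exists 0, 0; rewrite big_ord0 !mul0r addr0.
  by split=> //; apply: O0.
rewrite big_ord_recr /=.
have [|a [b [Oa Ob ->]]] := IH; first by move=> k kr; apply/Mv/ltnW.
have [a' [b' [Oa' Ob' ->]]] := Mv r (ltnSn r).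
exists (a + c r * a'), (b + c r * b'); split; last by ring.
  by apply: OD => //; apply: OM.
by apply: OD => //; apply: OM.
Qed.

Hypothesis w_mod : forall k, (k <= i)%N -> module2 (w k).

Lemma partial_reduction f p q : module2 f -> (i.+1 < K)%N ->
  (q <= l i.+1)%N -> order_ge p f ->
  exists2 T, repr_ge w i.+1 p T & order_ge q (f - T).
Proof.
move=> Mf iK1 ql fp; elim: q ql => [|q IH] ql.
  by exists 0; [exact: repr_ge0 | exact: order_ge0].
have [|T Tp fT] := IH; first exact: ltnW.
have [z|nz] := order_eqP fT; first by exists T => //; apply: order_geS.
have pq : (p <= q)%N.
  by apply: order_ge_eq nz; apply: order_geB => //; apply: repr_ge_order Tp.
have MR : module2 (f - T).
  have [a [b [Oa Ob fE]]] := Mf.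
  have [c [Oc _ TE]] := Tp.
  have [|a' [b' [Oa' Ob' T'E]]] := @O_submodule i.+1 c w Oc.
    by move=> k; apply: w_mod.
  exists (a - a'), (b - b'); split; [exact: OB | exact: OB |].
  by rewrite TE T'E fE; ring.
have [k [h [ki /O_elt[d Od dh] qE]]] := value_lt_gen iK1 MR nz ql.
have dw : order_eq q (d * w k).
  by rewrite qE addnC; apply: order_eqM => //; apply: w_ord.
pose r := (f - T)`_q / (d * w k)`_q.
exists (T + r *: (d * w k)).
  apply: repr_geD => //; apply: repr_geZ => //; apply: (repr_geW pq).
  by apply: repr_ge_single => //; case: dw.
rewrite opprD addrA; apply: order_geS.
  by apply: order_geB => //; apply: order_geZ; case: dw.
by rewrite coefB coefZ /r divfK ?subrr //; case: dw.
Qed.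

Lemma S_poly_module g : (forall k, O (g k)) -> module2 (S_poly g).
Proof. by move=> Og; apply: O_submodule => // k; apply: w_mod. Qed.

(* Among the elements of order l i.+1, one whose representation has the largest
   possible order p: by maximality p is at least the lower axis, and the
   reduction of the S-pair at that axis has order exactly l i.+1. *)
Lemma next_generator : (i.+1 < K)%N -> (low i < l i.+1)%N /\
  exists g T R, [/\ S_pair g, repr_ge w i.+1 (low i).+1 T, module2 R,
    order_eq (l i.+1) R & S_poly g = T + R].
Proof.
move=> iK1; set la := l i.+1.
have la_high : (la < high i)%N.
  by case: (cor (l_new iK1)) => [|[h _]]; rewrite -/la; lia.
pose Q p := exists f, order_eq la f /\ repr_ge w i.+1 p f.
have Q0 : exists p, `[< Q p >].
  have [f Mf fl] := basis_elt iK1.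
  by exists 0%N; apply/asboolP; exists f; split=> //; apply: module2_repr.
have Qle p : `[< Q p >] -> (p <= la)%N.
  by move=> /asboolP[f [fl fp]]; apply: order_ge_eq fl; apply: repr_ge_order fp.
have [p /asboolP[f [fl fp]] maxp] := ex_maxnP Q0 Qle.
have noQ : ~ Q p.+1 by move=> /asboolP/maxp; rewrite ltnn.
have w_ord' k : (k < i.+1)%N -> order_eq (l k) (w k) by apply: w_ord.
have p_lt : (p < la)%N.
  rewrite ltn_neqAle Qle ?andbT; last by apply/asboolP; exists f.
  apply/eqP => pE; apply: (l_new iK1); rewrite -/la -pE.
  by apply: (repr_order_gen w_ord' fp); rewrite pE; case: fl.
have fp1 : order_ge p.+1 f by case: fl => fl _; apply: order_geW fl.
have [g gS] := S_pair_ex.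
have [c [Oc c0 cp cf]] := reduce_by_S gS (ltn_trans p_lt la_high) fp fp1.
have low_p : (low i <= p)%N.
  rewrite leqNgt; apply/negP => /c0 cE; apply: noQ; exists f; split=> //.
  by move: cf; rewrite cE mul0r subr0.
have [Og gl gi gSo] := gS.
have MS := S_poly_module Og.
have [T Tl ST] := partial_reduction MS iK1 (leqnn la) gSo.
split; first by lia.
exists g, T, (S_poly g - T).
have cT : repr_ge w i.+1 p.+1 (c * T).
  have -> : p.+1 = (p - low i + (low i).+1)%N by lia.
  exact: repr_geM.
split=> //.
- have [a [b [Oa Ob ->]]] := MS; have [d [Od _ ->]] := Tl.
  have [|a' [b' [Oa' Ob' ->]]] := @O_submodule i.+1 d w Od.
    by move=> k; apply: w_mod.
  by exists (a - a'), (b - b'); split; [exact: OB | exact: OB | ring].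
- have [z|//] := order_eqP ST; exfalso; apply: noQ.
  exists (f - c * (S_poly g - T)); split.
    by apply: order_eq_subl => //; apply: order_geMr; apply: order_geS.
  have -> : f - c * (S_poly g - T) = f - c * S_poly g + c * T by ring.
  exact: repr_geD.
- by rewrite addrC subrK.
Qed.

End Step.

Definition standard_basis w i := [/\ w 0 = e0, w 1 = e1,
  forall k, (k <= i)%N -> order_eq (l k) (w k),
  forall k, (k <= i)%N -> module2 (w k) & resolves w i].

Lemma standard_basis1 : exists w, standard_basis w 1.
Proof.
exists (fun k => if k == 0 then e0 else e1); split=> //.
- by move=> [|[|//]] _; rewrite ?l0 ?l1.
- move=> [|[|//]] _ /=; [exists 1, 0 | exists 0, 1].
    by split; rewrite -1?[1]/(1%:P) -1?[0]/(0%:P) // mul1r mul0r addr0.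
  by split; rewrite -1?[1]/(1%:P) -1?[0]/(0%:P) // mul1r mul0r add0r.
- move=> p f _ [c [Oc _ fE]] fp.
  apply: repr_geS => //; exists c; split=> // k; rewrite ltnS leqn0 => /eqP ->.
  by move: fp; rewrite fE big_ord1.
Qed.

Lemma standard_basisS w i : (0 < i)%N -> (i.+1 < K)%N -> corners n m l i ->
  standard_basis w i -> (low i < l i.+1)%N /\ exists w', standard_basis w' i.+1.
Proof.
move=> i0 iK1 cor [w0 w1 w_ord w_mod w_res].
have iK := ltnW iK1.
have [low_lt [g [T [R [gS Tl MR Rl SE]]]]] :=
  next_generator w0 w1 i0 iK w_ord cor w_res w_mod iK1.
split=> //; exists (fun k => if k == i.+1 then R else w k).
have ww' k : (k < i.+1)%N -> w k = if k == i.+1 then R else w k.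
  by move=> ki; rewrite ltn_eqF.
split=> //=.
- by case: eqP => // e; move: i0; lia.
- by move=> k; rewrite leq_eqVlt; case: eqP => [->|_ /w_ord].
- by move=> k; rewrite leq_eqVlt; case: eqP => [->|_ /w_mod].
move=> p f ph fp fp1.
have hd := high_decr n_ge2 n_lt_m co_nm l0 l1 l_mono l_new i0 iK1 cor low_lt.
have fp' : repr_ge w i.+1 p f.
  by apply: eq_repr_ge fp => k ki; rewrite ltn_eqF.
have [c [Oc c0 cp cf]] :=
  reduce_by_S i0 iK w_ord w_res gS (ltn_trans ph hd) fp' fp1.
have lift q h : repr_ge w i.+1 q h ->
    repr_ge (fun k => if k == i.+1 then R else w k) i.+2 q h.
  by move=> /(eq_repr_ge ww') hq; apply: repr_geS.
have -> : f = f - c * S_poly w i g + (c * T + c * R) by rewrite SE; ring.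
apply: repr_geD => //; first exact: lift.
have [c_eq0|low_p] := ltnP p (low i).
  by rewrite c0 // !mul0r addr0; apply: repr_ge0.
have pE : p.+1 = (p - low i + (low i).+1)%N by lia.
apply: repr_geD => //.
  by apply: lift; rewrite pE; apply: repr_geM.
have RE : R = (if i.+1 == i.+1 then R else w i.+1) by rewrite eqxx.
rewrite {2}RE.
apply: (@repr_ge_single _ _ _ (fun k => if k == i.+1 then R else w k) i.+2 p.+1 i.+1) => //.
rewrite eqxx pE; apply: order_geM => //; case: Rl => Rl _.
exact: order_geW Rl.
Qed.

Lemma standard_basis_corners i : (0 < i < K)%N ->
  corners n m l i /\ exists w, standard_basis w i.
Proof.
elim: i => // -[_ /andP[_ K1]|i IH /andP[_ iK]].
  split; last exact: standard_basis1.
  exact: (corners1 n_ge2 n_lt_m co_nm l0 l1 l_new K1).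
have [|cor [w wi]] := IH; first by rewrite /= ltnW.
have [low_lt w'] := standard_basisS (ltn0Sn i) iK cor wi.
split=> //.
exact: (cornersS n_ge2 n_lt_m co_nm l0 l1 l_mono l_new).
Qed.

Lemma conductor_basis i : (0 < i)%N -> K = i.+1 ->
  (conductor (D K) + n + m = high i + 1)%N.
Proof.
move=> i0 KE; have iK : (0 < i < K)%N by rewrite i0 KE ltnS leqnn.
have [cor _] := standard_basis_corners iK.
rewrite {1}KE.
exact: (corners_conductor n_ge2 n_lt_m co_nm l0 l1 l_mono l_new iK cor).
Qed.

End Delorme.

(** * The algebra generated by two polynomials *)

Section MonomialSpan.
Variable F : fieldType.
Implicit Types (f g x y u w : {poly F}).

Inductive monomial_span x y : {poly F} -> Prop :=
| span0 : monomial_span x y 0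
| span_cons a b c f : monomial_span x y f ->
    monomial_span x y (c *: (x ^+ a * y ^+ b) + f).

Lemma span_monomial x y a b : monomial_span x y (x ^+ a * y ^+ b).
Proof.
by rewrite -[_ * _]scale1r -[_ *: _]addr0; apply/span_cons/span0.
Qed.

Lemma spanD x y f g :
  monomial_span x y f -> monomial_span x y g -> monomial_span x y (f + g).
Proof.
move=> fs gs; elim: fs => [|a b c h _ IH]; first by rewrite add0r.
by rewrite -addrA; apply: span_cons.
Qed.

Lemma span_mul_monomial x y a b c f :
  monomial_span x y f -> monomial_span x y (c *: (x ^+ a * y ^+ b) * f).
Proof.
elim=> [|a' b' c' h _ IH]; first by rewrite mulr0; apply: span0.
rewrite mulrDr; have -> : c *: (x ^+ a * y ^+ b) * (c' *: (x ^+ a' * y ^+ b')) =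
    (c * c') *: (x ^+ (a + a') * y ^+ (b + b')).
  by rewrite -scalerAl -scalerAr scalerA !exprD; congr (_ *: _); ring.
exact: span_cons.
Qed.

Lemma spanM x y f g :
  monomial_span x y f -> monomial_span x y g -> monomial_span x y (f * g).
Proof.
move=> fs gs; elim: fs => [|a b c h _ IH]; first by rewrite mul0r; apply: span0.
by rewrite mulrDl; apply: spanD => //; apply: span_mul_monomial.
Qed.

Lemma spanC x y c : monomial_span x y c%:P.
Proof.
have -> : c%:P = c *: (x ^+ 0 * y ^+ 0) + 0.
  by rewrite !expr0 mulr1 addr0 alg_polyC.
exact/span_cons/span0.
Qed.

Lemma spanZ x y c f : monomial_span x y f -> monomial_span x y (c *: f).
Proof. by move=> fs; rewrite -mul_polyC; apply/spanM/fs/spanC. Qed.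

Lemma spanX x y k f : monomial_span x y f -> monomial_span x y (f ^+ k).
Proof.
by move=> fs; elim: k => [|k IH]; [exact: (spanC x y 1) | rewrite exprS; apply: spanM].
Qed.

Lemma span_x x y : monomial_span x y x.
Proof. by have := span_monomial x y 1 0; rewrite expr1 expr0 mulr1. Qed.

Lemma span_y x y : monomial_span x y y.
Proof. by have := span_monomial x y 0 1; rewrite expr1 expr0 mul1r. Qed.

Lemma span_sum x y (I : Type) (r : seq I) (P : pred I) (f : I -> {poly F}) :
  (forall i, P i -> monomial_span x y (f i)) ->
  monomial_span x y (\sum_(i <- r | P i) f i).
Proof. by move=> fs; apply: big_ind => //; [exact: span0 | exact: spanD]. Qed.

Lemma span_trans x y u w f : monomial_span x y u -> monomial_span x y w ->
  monomial_span u w f -> monomial_span x y f.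
Proof.
move=> us ws; elim=> [|a b c g _ gs]; first exact: span0.
by apply: spanD => //; apply/spanZ/spanM; apply: spanX.
Qed.

(* The forms A dx + B dy, with dx replaced by 'X * x', so that the order of an
   element is the differential value of the form. *)
Definition diff_module x y :=
  module2 (monomial_span x y) ('X * x^`()) ('X * y^`()).

Lemma diff_moduleD x y f g : diff_module x y f -> diff_module x y g ->
  diff_module x y (f + g).
Proof.
move=> [a [b [Oa Ob ->]]] [c [d [Oc Od ->]]].
by exists (a + c), (b + d); split; [exact: spanD | exact: spanD | ring].
Qed.

Lemma diff_moduleM x y f g : monomial_span x y f -> diff_module x y g ->
  diff_module x y (f * g).
Proof.
move=> fs [a [b [Oa Ob ->]]].
by exists (f * a), (f * b); split; [exact: spanM | exact: spanM | ring].
Qed.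

Lemma diff_module_deriv x y u : monomial_span x y u -> diff_module x y ('X * u^`()).
Proof.
elim=> [|a b c f _ IH].
  by exists 0, 0; split; rewrite ?deriv0; [exact: span0 | exact: span0 | ring].
rewrite derivD mulrDr; apply: diff_moduleD => //.
have id1 (t d p q : {poly F}) : t * (d * p * q) = p * q * (t * d) by ring.
have id2 (t d p q : {poly F}) : t * (p * (d * q)) = p * q * (t * d) by ring.
rewrite derivZ derivM !deriv_exp.
exists (c *: ((x ^+ a.-1 * y ^+ b) *+ a)), (c *: ((x ^+ a * y ^+ b.-1) *+ b)).
split.
- apply: spanZ; rewrite -mulr_natl -polyC_natr.
  by apply: spanM; [exact: spanC | exact: span_monomial].
- apply: spanZ; rewrite -mulr_natl -polyC_natr.
  by apply: spanM; [exact: spanC | exact: span_monomial].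
- rewrite -scalerAr -!scalerAl -scalerDr; congr (_ *: _).
  rewrite mulrDr !mulrnAl !mulrnAr; congr (_ *+ _ + _ *+ _).
    exact: id1.
  exact: id2.
Qed.

Lemma diff_module_trans x y u w f : monomial_span x y u -> monomial_span x y w ->
  diff_module u w f -> diff_module x y f.
Proof.
move=> us ws [a [b [Oa Ob ->]]].
apply: diff_moduleD; apply: diff_moduleM.
- exact: span_trans Oa.
- exact: diff_module_deriv.
- exact: span_trans Ob.
- exact: diff_module_deriv.
Qed.

Section Values.
Variables (n m : nat) (u w : {poly F}).
Hypotheses (n_gt0 : (0 < n)%N) (m_gt0 : (0 < m)%N) (co_nm : coprime n m).
Hypotheses (ord_u : order_eq n u) (ord_w : order_eq m w).
Local Notation G := (semigroup2 n m).

Lemma order_monomial a b : order_eq (a * n + b * m) (u ^+ a * w ^+ b).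
Proof. by apply: order_eqM; apply: order_eqX. Qed.

Lemma span_elt v : G v -> exists2 f, monomial_span u w f & order_eq v f.
Proof.
move=> [a [b ->]]; exists (u ^+ a * w ^+ b); first exact: span_monomial.
exact: order_monomial.
Qed.

Let graded (h : nat -> {poly F}) := forall p, h p = 0 \/
  exists a b c, [/\ p = (a * n + b * m)%N, c != 0 & h p = c *: (u ^+ a * w ^+ b)].

Let graded_order h p : graded h -> h p = 0 \/ G p /\ order_eq p (h p).
Proof.
move=> /(_ p)[->|[a [b [c [pE c0 ->]]]]]; first by left.
right; split; first by exists a, b.
by rewrite pE; apply/order_eqZ/order_monomial.
Qed.

(* Below n * m every value is the weight of at most one monomial, so that no
   cancellation can occur. *)
Lemma span_graded f : monomial_span u w f ->
  exists2 h, graded h & order_ge (n * m) (f - \sum_(p < n * m) h p).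
Proof.
elim=> [|a b c g _ [h hG hg]].
  exists (fun=> 0); first by left.
  by rewrite big1 // subr0; apply: order_ge_zero.
have ord_ab := order_monomial a b.
have [le|lt] := leqP (n * m) (a * n + b * m).
  exists h => //; rewrite -addrA; apply: order_geD => //; apply: order_geZ.
  by apply: order_geW le _; case: ord_ab.
pose p0 := Ordinal lt.
exists (fun p => if p == p0 :> nat then c *: (u ^+ a * w ^+ b) + h p else h p).
  move=> p; case: eqP => [->|_] //.
  have [->|c0] := eqVneq c 0; first by rewrite scale0r add0r; apply: hG.
  have [->|[a' [b' [c' [pE c'0 ->]]]]] := hG p0.
    by right; exists a, b, c; rewrite addr0.
  have [-> ->] := semigroup2_inj n_gt0 m_gt0 co_nm lt pE.
  rewrite -scalerDl; have [->|cc'] := eqVneq (c + c') 0.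
    by left; rewrite scale0r.
  by right; exists a', b', (c + c'); split=> //; rewrite pE.
have -> : \sum_(p < n * m) (if p == p0 :> nat then c *: (u ^+ a * w ^+ b) + h p else h p)
    = c *: (u ^+ a * w ^+ b) + \sum_(p < n * m) h p.
  rewrite (bigD1 p0) //= eqxx [in RHS](bigD1 p0) //= addrA; congr (_ + _ + _).
  by apply: eq_bigr => p /negbTE; rewrite -val_eqE /= => ->.
by rewrite opprD addrACA subrr add0r.
Qed.

Lemma span_order f v : monomial_span u w f -> order_eq v f -> G v.
Proof.
move=> /span_graded[h hG hf] [fv fv0].
have [le|lt] := leqP (n * m) v.
  by apply: (semigroup2_large n_gt0 m_gt0 co_nm); lia.
have coefE p : (p < n * m)%N -> (forall q, (q < p)%N -> h q = 0) ->
    f`_p = (h p)`_p.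
  move=> pN hp; have /eqP := hf p pN; rewrite coefB subr_eq0 coef_sum => /eqP ->.
  rewrite (bigD1 (Ordinal pN)) //= big1 ?addr0 // => q qp.
  have [qp'|pq] := ltnP q p; first by rewrite hp ?coef0.
  have [->|[_ [hq _]]] := graded_order q hG; first by rewrite coef0.
  by apply: hq; rewrite ltn_neqAle pq andbT eq_sym.
have h0 p : (p < v)%N -> h p = 0.
  elim/ltn_ind: p => p IH pv; have [//|[_ [_]]] := graded_order p hG.
  rewrite -coefE ?fv ?eqxx //; first exact: ltn_trans pv lt.
  by move=> q qp; apply: IH => //; apply: ltn_trans pv.
have [hv|[]//] := graded_order v hG.
by move: fv0; rewrite coefE // hv coef0 eqxx.
Qed.

Lemma order_eq_deriv p f : p%:R != 0 :> F -> (0 < p)%N -> order_eq p f ->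
  order_eq p ('X * f^`()).
Proof.
case: p => // p p0 _ [fp fp0]; split.
  move=> [|i] ip; rewrite coefXM //= coef_deriv fp //.
  by rewrite mul0rn.
by rewrite coefXM /= coef_deriv -mulr_natl mulf_neq0.
Qed.

Lemma diff_module_elt v : n%:R != 0 :> F -> m%:R != 0 :> F -> G v -> (0 < v)%N ->
  exists2 f, diff_module u w f & order_eq v f.
Proof.
move=> n0 m0 [[|a] [[|b] ->]] // _.
- exists (w ^+ b * ('X * w^`())).
    apply: diff_moduleM; last exact/diff_module_deriv/span_y.
    exact/spanX/span_y.
  rewrite mulSn add0n addnC; apply: order_eqM; first exact: order_eqX.
  exact: order_eq_deriv.
- exists (u ^+ a * w ^+ 0 * ('X * u^`())).
    apply: diff_moduleM; last exact/diff_module_deriv/span_x.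
    exact: span_monomial.
  rewrite mulSn -addnA addnC; apply: order_eqM; first exact: order_monomial.
  exact: order_eq_deriv.
- exists (u ^+ a * w ^+ b.+1 * ('X * u^`())).
    apply: diff_moduleM; last exact/diff_module_deriv/span_x.
    exact: span_monomial.
  rewrite mulSn -addnA addnC; apply: order_eqM; first exact: order_monomial.
  exact: order_eq_deriv.
Qed.

End Values.
End MonomialSpan.

(** * Power series and their truncations *)

Import Order.TTheory Num.Theory.

Local Open Scope complex_scope.

Section Truncation.
Variable R : realType.
Implicit Types (a b x y : nat -> R[i]) (f g X Y : {poly R[i]}) (N : nat).

Definition agree N f a := forall k, (k < N)%N -> f`_k = a k.

Lemma agree_poly N a : agree N (\poly_(i < N) a i) a.
Proof. by move=> k kN; rewrite coef_poly kN. Qed.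

Lemma agree_order N v f a : agree N f a -> (v < N)%N ->
  order_eq v f <-> has_order a v.
Proof.
move=> fa vN; split=> -[].
  move=> fv fv0; split=> [|i iv]; first by rewrite -fa.
  by rewrite -fa ?fv //; apply: ltn_trans vN.
move=> av av0; split=> [i iv|]; last by rewrite fa.
by rewrite fa ?av0 //; apply: ltn_trans vN.
Qed.

Lemma agreeM N f g a b : agree N f a -> agree N g b -> agree N (f * g) (mul1 a b).
Proof.
move=> fa gb k kN; rewrite coefM; apply: eq_bigr => i _.
rewrite fa ?gb //; first exact: leq_ltn_trans (leq_subr _ _) kN.
by apply: leq_trans kN; apply: ltn_ord.
Qed.

Lemma agreeX N f a e : agree N f a -> agree N (f ^+ e) (pow1 a e).
Proof.
move=> fa; elim: e => [|e IH]; first by move=> k _; rewrite expr0 coef1.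
by rewrite exprS; apply: agreeM.
Qed.

Lemma order_ge1 N f a : (0 < N)%N -> a 0%N = 0 -> agree N f a -> order_ge 1 f.
Proof. by move=> N0 a0 fa [|//] _; rewrite fa. Qed.

Lemma order_ge_exp e f : order_ge 1 f -> order_ge e (f ^+ e).
Proof.
move=> f1; elim: e => [//|e IH]; rewrite exprS -add1n; exact: order_geM.
Qed.

Lemma sum_widen_zero (V : nmodType) (p q : nat) (G : nat -> V) : (p <= q)%N ->
  (forall i, (p <= i)%N -> G i = 0) -> \sum_(i < p) G i = \sum_(i < q) G i.
Proof.
move=> pq G0; rewrite -!(big_mkord xpredT) (big_cat_nat _ pq) //=.
by rewrite [X in _ + X]big_nat_cond [X in _ + X]big1 ?addr0 // => i /andP[/andP[/G0]].
Qed.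

Lemma agree_comp N f g a b : (0 < N)%N -> b 0%N = 0 ->
  agree N f a -> agree N g b -> agree N (f \Po g) (comp1 a b).
Proof.
move=> N0 b0 fa gb k kN; have g1 := order_ge1 N0 b0 gb.
rewrite coef_comp_poly.
have -> : comp1 a b k = \sum_(i < k.+1) f`_i * (g ^+ i)`_k.
  apply: eq_bigr => i _; rewrite fa ?(agreeX _ gb) //.
  by apply: leq_ltn_trans kN; rewrite -ltnS.
pose M := maxn (size f) k.+1.
rewrite (@sum_widen_zero _ _ M (fun i => f`_i * (g ^+ i)`_k)) ?leq_maxl //; last first.
  by move=> i ?; rewrite nth_default ?mul0r.
rewrite (@sum_widen_zero _ k.+1 M (fun i => f`_i * (g ^+ i)`_k)) ?leq_maxr // => i ki.
by rewrite (order_ge_exp g1) ?mulr0.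
Qed.

Lemma agree_deriv N f a : agree N.+1 f a -> agree N f^`() (deriv1 a).
Proof. by move=> fa k kN; rewrite coef_deriv fa // -mulr_natl. Qed.

Section Curve.
Variables (N : nat) (x y : nat -> R[i]) (X Y : {poly R[i]}).
Hypotheses (N_gt0 : (0 < N)%N) (x0 : x 0%N = 0) (y0 : y 0%N = 0).
Hypotheses (Xx : agree N X x) (Yy : agree N Y y).

Let monoE i j k : (k < N)%N ->
  mul1 (pow1 x i) (pow1 y j) k = (X ^+ i * Y ^+ j)`_k.
Proof. by move=> kN; rewrite (agreeM (agreeX _ Xx) (agreeX _ Yy)). Qed.

Let mono0 i j k : (k < i + j)%N -> (X ^+ i * Y ^+ j)`_k = 0.
Proof.
move=> kij; apply: (order_geM (order_ge_exp _) (order_ge_exp _)) kij.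
  exact: (order_ge1 N_gt0 x0 Xx).
exact: (order_ge1 N_gt0 y0 Yy).
Qed.

Lemma comp2_span (h : nat -> nat -> R[i]) :
  exists2 f, monomial_span X Y f & agree N f (comp2 h x y).
Proof.
exists (\sum_(i < N) \sum_(j < N) h i j *: (X ^+ i * Y ^+ j)).
  by do 2!apply: span_sum => ? _; apply/spanZ/span_monomial.
move=> k kN; rewrite coef_sum /comp2.
transitivity (\sum_(i < N) \sum_(j < N) h i j * (X ^+ i * Y ^+ j)`_k).
  by apply: eq_bigr => i _; rewrite coef_sum; apply: eq_bigr => j _; rewrite coefZ.
pose T i j := h i j * (X ^+ i * Y ^+ j)`_k.
rewrite -[LHS](@sum_widen_zero _ k.+1 N (fun i => \sum_(j < N) T i j)) // => [|i ki].
  apply: eq_bigr => i _.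
  rewrite -(@sum_widen_zero _ k.+1 N (T i)) // => [|j kj].
    by apply: eq_bigr => j _; rewrite monoE.
  by rewrite /T mono0 ?mulr0 //; lia.
by rewrite big1 // => j _; rewrite /T mono0 ?mulr0 //; lia.
Qed.

Lemma span_comp2 f : monomial_span X Y f ->
  exists2 h, convergent2 h & agree N f (comp2 h x y).
Proof.
suff E : monomial_span X Y f -> exists2 h : nat -> nat -> R[i],
    (exists M : R, forall n, \sum_(i < n) \sum_(j < n) `|h i j| <= M%:C) &
    agree N f (comp2 h x y).
  move=> /E[h [M hM] fh]; exists h => //; exists 1, M; split=> // n.
  rewrite (eq_bigr (fun i : 'I_n => \sum_(j < n) `|h i j|)); first exact: hM.
  by move=> i _; apply: eq_bigr => j _; rewrite expr1n mulr1.
elim=> [|a b c g _ [h [M hM] gh]].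
  exists (fun _ _ => 0).
    by exists 0 => n; rewrite big1 // => i _; rewrite big1 // => j _; rewrite normr0.
  move=> k _; rewrite coef0 /comp2 big1 // => i _; rewrite big1 // => j _.
  by rewrite mul0r.
pose d i j := if (i == a) && (j == b) then c else 0.
exists (fun i j => d i j + h i j).
  exists (complex.Re `|c| + M) => n.
  have cE : (complex.Re `|c|)%:C = `|c| by rewrite RRe_real // normr_real.
  rewrite rmorphD /= cE.
  apply: (@le_trans _ _ (\sum_(i < n) \sum_(j < n) (`|d i j| + `|h i j|))).
    by do 2!apply: ler_sum => ? _; apply: ler_normD.
  rewrite [leLHS](eq_bigr (fun i : 'I_n => \sum_(j < n) `|d i j| + \sum_(j < n) `|h i j|)).
    rewrite big_split /= lerD ?hM //.
    have [an|na] := ltnP a n; last first.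
      rewrite big1 // => i _; rewrite big1 // => j _.
      by rewrite /d ltn_eqF ?normr0 //; apply: leq_trans na.
    rewrite (bigD1 (Ordinal an)) //= [X in _ + X]big1 ?addr0; last first.
      move=> i ia; rewrite big1 // => j _; rewrite /d ifF ?normr0 //.
      by move: ia; rewrite -val_eqE /= => /negbTE ->.
    have [bn|nb] := ltnP b n; last first.
      rewrite big1 // => j _.
      by rewrite /d eqxx ltn_eqF ?normr0 //; apply: leq_trans nb.
    rewrite (bigD1 (Ordinal bn)) //= [X in _ + X]big1 ?addr0; last first.
      move=> j jb; rewrite /d ifF ?normr0 //.
      by move: jb; rewrite -val_eqE /= eqxx => /negbTE ->.
    by rewrite /d !eqxx.
  by move=> i _; rewrite big_split.
move=> k kN; rewrite coefD coefZ gh // /comp2.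
rewrite [RHS](eq_bigr (fun i : 'I_k.+1 =>
   \sum_(j < k.+1) d i j * mul1 (pow1 x i) (pow1 y j) k +
   \sum_(j < k.+1) h i j * mul1 (pow1 x i) (pow1 y j) k)); last first.
  by move=> i _; rewrite -big_split; apply: eq_bigr => j _; rewrite mulrDl.
rewrite big_split /=; congr (_ + _); rewrite -(monoE _ _ kN).
have [ka|ak] := ltnP k a.
  rewrite monoE // mono0 ?mulr0; last by lia.
  rewrite big1 // => i _; rewrite big1 // => j _.
  by rewrite /d ltn_eqF ?mul0r //; apply: leq_trans ka.
rewrite -ltnS in ak.
rewrite (bigD1 (Ordinal ak)) //= [X in _ + X]big1 ?addr0; last first.
  move=> i ia; rewrite big1 // => j _; rewrite /d ifF ?mul0r //.
  by move: ia; rewrite -val_eqE /= => /negbTE ->.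
have [kb|bk] := ltnP k b.
  rewrite monoE // mono0 ?mulr0; last by lia.
  rewrite big1 // => j _.
  by rewrite /d [(j == b :> nat)]ltn_eqF ?andbF ?mul0r //; apply: leq_trans kb.
rewrite -ltnS in bk.
rewrite (bigD1 (Ordinal bk)) //= [X in _ + X]big1 ?addr0; last first.
  move=> j jb; rewrite /d ifF ?mul0r //.
  by move: jb; rewrite -val_eqE /= eqxx => /negbTE ->.
by rewrite /d !eqxx.
Qed.

Lemma pullback_coef A B f g : agree N f (comp2 A x y) -> agree N g (comp2 B x y) ->
  forall k, (k.+1 < N)%N ->
  (f * ('X * X^`()) + g * ('X * Y^`()))`_k.+1 = pullback A B x y k.
Proof.
move=> fA gB k kN; have -> : f * ('X * X^`()) + g * ('X * Y^`()) =
  'X * (f * X^`() + g * Y^`()) by ring.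
rewrite coefXM /= coefD /pullback.
case: N N_gt0 Xx Yy fA gB kN => // N' _ Xx' Yy' fA gB kN.
have le (p : {poly R[i]}) c : agree N'.+1 p c -> agree N' p c.
  by move=> pc j jN; apply/pc/ltnW.
by rewrite (agreeM (le _ _ fA) (agree_deriv Xx')) // (agreeM (le _ _ gB) (agree_deriv Yy')).
Qed.

Lemma Gamma_trunc v : (v < N)%N ->
  (exists h, convergent2 h /\ has_order (comp2 h x y) v) <->
  (exists2 f, monomial_span X Y f & order_eq v f).
Proof.
move=> vN; split.
  move=> [h [_ hv]]; have [f fs fh] := comp2_span h.
  by exists f => //; apply/(agree_order fh).
move=> [f fs fv]; have [h hc fh] := span_comp2 fs.
by exists h; split=> //; apply/(agree_order fh).
Qed.

Lemma Lambda_trunc v : (v < N)%N ->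
  (exists A B k, [/\ convergent2 A, convergent2 B,
     has_order (pullback A B x y) k & v = k.+1]) <->
  (exists2 f, diff_module X Y f & order_eq v f).
Proof.
move=> vN; have f00 (f g : {poly R[i]}) : (f * ('X * X^`()) + g * ('X * Y^`()))`_0 = 0.
  have -> : f * ('X * X^`()) + g * ('X * Y^`()) =
    'X * (f * X^`() + g * Y^`()) by ring.
  by rewrite coefXM.
split.
  move=> [A [B [k [_ _ [kv k0] vk]]]]; subst v.
  have [f fs fA] := comp2_span A; have [g gs gB] := comp2_span B.
  have E := pullback_coef fA gB.
  exists (f * ('X * X^`()) + g * ('X * Y^`())); first by exists f, g.
  split; last by rewrite E.
  move=> [|i] ik; first exact: f00.
  by rewrite E ?k0 //; apply: ltn_trans vN.
move=> [_ [f [g [fs gs ->]]] [fv fv0]].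
have [A Ac fA] := span_comp2 fs; have [B Bc gB] := span_comp2 gs.
have E := pullback_coef fA gB.
case: v vN fv fv0 => [|v] vN fv fv0; first by rewrite f00 eqxx in fv0.
exists A, B, v; split=> //; split; first by rewrite -E.
by move=> i iv; rewrite -E ?fv //; apply: ltn_trans vN.
Qed.

End Curve.
End Truncation.

Lemma comp_polyXn (F : fieldType) (f g : {poly F}) k :
  f ^+ k \Po g = (f \Po g) ^+ k.
Proof.
elim: k => [|k IH]; first by rewrite !expr0 -[1]/(1%:P) comp_polyC.
by rewrite !exprS comp_polyM IH.
Qed.

Lemma order_eq_comp (F : fieldType) (f g : {poly F}) v :
  order_eq 1 g -> order_eq v f -> order_eq v (f \Po g).
Proof.
move=> g1 [/order_geP[h ->]]; rewrite coefXnM ltnn subnn => h0.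
rewrite comp_polyM comp_polyXn comp_polyX.
rewrite -[v in order_eq v]addn0 -[v in order_eq (v + _)]muln1.
apply: order_eqM; first exact: order_eqX.
split=> //; have g0 : g`_0 = 0 by case: g1 => g1 _; apply: g1.
by rewrite -horner_coef0 horner_comp horner_coef0 g0 horner_coef0.
Qed.

Lemma puiseux_generators (R : realType) (m n N : nat) (x y : nat -> R[i])
    (X Y : {poly R[i]}) :
  single_puiseux_pair m n x y -> (m < N)%N -> agree N X x -> agree N Y y ->
  exists u w, [/\ monomial_span X Y u, monomial_span X Y w,
    monomial_span u w X & monomial_span u w Y] /\ (order_eq n u /\ order_eq m w).
Proof.
move=> [[n2 nm co] [a [b [c [d [tau [phi]]]]]]] [[det _ tau0 tau1] [xn yphi _ phi0 phim]].
move=> mN Xx Yy; have N0 : (0 < N)%N by lia.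
pose T := \poly_(i < N) tau i.
have Tt : agree N T tau := agree_poly _.
have T1 : order_eq 1 T.
  split; first exact: order_ge1 Tt.
  by rewrite Tt //; lia.
pose u := a *: X + b *: Y; pose w1 := c *: X + d *: Y.
have uT : agree N (u \Po T) (fun k => (k == n)%N%:R).
  move=> k kN; rewrite -xn; apply: (agree_comp N0 tau0 _ Tt kN) => j jN.
  by rewrite coefD !coefZ Xx ?Yy.
have w1T : agree N (w1 \Po T) phi.
  move=> k kN; rewrite -yphi; apply: (agree_comp N0 tau0 _ Tt kN) => j jN.
  by rewrite coefD !coefZ Xx ?Yy.
have order_of f v : order_eq v (f \Po T) -> order_eq v f.
  move=> fv; have [|p fp] := @order_eq_ex _ f.
    by apply: contraTneq (order_eq_neq0 fv) => ->; rewrite comp_poly0 eqxx.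
  by rewrite (order_eq_inj fv (order_eq_comp T1 fp)).
have ord_u : order_eq n u.
  apply: order_of; apply/(agree_order uT); first lia.
  split=> [|i]; first by rewrite eqxx oner_neq0.
  by move=> ltin; rewrite ltn_eqF.
pose q := \sum_(k < m) phi (k * n)%N *: u ^+ k.
pose w := w1 - q.
have uTX k j : (j < N)%N -> ((u ^+ k) \Po T)`_j = (j == k * n)%N%:R.
  move=> jN; rewrite comp_polyXn (agreeX k uT jN).
  have Xn : agree N 'X^n (fun k => (k == n)%N%:R : R[i]) by move=> i _; rewrite coefXn.
  by rewrite -(agreeX k Xn jN) -exprM coefXn mulnC.
have wT j : (j < N)%N ->
    (w \Po T)`_j = phi j - \sum_(k < m) phi (k * n)%N * (j == k * n)%N%:R.
  move=> jN; rewrite comp_polyB coefB w1T //; congr (_ - _).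
  rewrite /q (raddf_sum (comp_poly T)) coef_sum; apply: eq_bigr => k _.
  by rewrite /= comp_polyZ coefZ uTX.
have ord_w : order_eq m w.
  have nNm : ~~ (n %| m)%N.
    by apply/negP => /gcdn_idPl e; move: co; rewrite /coprime e; lia.
  apply: order_of; split=> [j jm|]; last first.
    rewrite wT // big1 ?subr0 // => k _.
    rewrite (_ : (_ == _) = false) ?mulr0 //.
    by apply: contraNF nNm => /eqP ->; apply: dvdn_mull.
  rewrite wT; last by lia.
  have [/dvdnP[k jE]|nj] := boolP (n %| j)%N; last first.
    rewrite phi0 // big1 ?subr0 // => k _.
    rewrite (_ : (_ == _) = false) ?mulr0 //.
    by apply: contraNF nj => /eqP ->; apply: dvdn_mull.
  have km : (k < m)%N by apply: leq_ltn_trans jm; rewrite jE leq_pmulr //; lia.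
  rewrite (bigD1 (Ordinal km)) //= -jE eqxx mulr1 big1 ?addr0 ?subrr // => i ik.
  rewrite (_ : (_ == _) = false) ?mulr0 //; apply: contraNF ik.
  by rewrite jE eqn_pmul2r -?val_eqE 1?eq_sym //; lia.
have q_span p r : monomial_span p r u -> monomial_span p r q.
  by move=> us; apply: span_sum => k _; apply/spanZ/spanX.
have us : monomial_span X Y u.
  by apply: spanD; apply: spanZ; [exact: span_x | exact: span_y].
have spanB p r f g : monomial_span p r f -> monomial_span p r g ->
    monomial_span p r (f - g).
  by move=> fs gs; rewrite -scaleN1r; apply/spanD/spanZ.
have w1s : monomial_span u w w1.
  by rewrite -[w1](subrK q); apply: spanD; [exact: span_y | apply/q_span/span_x].
exists u, w; split=> //; split=> //.
- apply: spanB; last exact: q_span.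
  by apply: spanD; apply: spanZ; [exact: span_x | exact: span_y].
- have -> : X = (a * d - b * c)^-1 *: (d *: u - b *: w1).
    apply/polyP => k; rewrite !(coefZ, coefD, coefB, coefN).
    by field; move: det; rewrite mulrC.
  by apply/spanZ/spanB; apply: spanZ => //; exact: span_x.
- have -> : Y = (a * d - b * c)^-1 *: (a *: w1 - c *: u).
    apply/polyP => k; rewrite !(coefZ, coefD, coefB, coefN).
    by field; move: det; rewrite mulrC.
  by apply/spanZ/spanB; apply: spanZ => //; exact: span_x.
Qed.

Section Cusp.
Variables (R : realType) (m n : nat) (C : cusp R m n).

Lemma cusp_pair : [/\ (1 < n)%N, (n < m)%N & coprime n m].
Proof. by have [] := param_puiseux C. Qed.

Lemma cusp_generators N : (m < N)%N -> exists u w : {poly R[i]},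
  [/\ order_eq n u, order_eq m w,
    forall v, (v < N)%N -> Gamma C v <->
      exists2 f, monomial_span u w f & order_eq v f &
    forall v, (v < N)%N -> Lambda C v <->
      exists2 f, diff_module u w f & order_eq v f].
Proof.
move=> mN; have N0 : (0 < N)%N by lia.
have [_ _ x0 y0] := param_parametrization C.
have Xx := agree_poly (N := N) (param_x C); have Yy := agree_poly (N := N) (param_y C).
have [u [w [[us ws Xs Ys] [un wm]]]] := puiseux_generators (param_puiseux C) mN Xx Yy.
exists u, w; split=> // v vN.
- apply: (iff_trans (Gamma_trunc N0 x0 y0 Xx Yy vN)); split=> -[f fs fv]; exists f => //.
    exact: span_trans fs.
  exact: span_trans fs.
- apply: (iff_trans (Lambda_trunc N0 x0 y0 Xx Yy vN)); split=> -[f fs fv]; exists f => //.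
    exact: diff_module_trans fs.
  exact: diff_module_trans fs.
Qed.

Lemma Gamma_cusp : Gamma C = semigroup2 n m.
Proof.
have [n2 nm co] := cusp_pair; apply/seteqP; split=> v.
  have mN : (m < maxn m v + 1)%N by lia.
  have vN : (v < maxn m v + 1)%N by lia.
  have [u [w [un wm G _]]] := cusp_generators mN.
  by move=> /(G v vN)[f fs fv]; apply: (span_order _ _ co un wm fs fv); lia.
have mN : (m < maxn m v + 1)%N by lia.
have vN : (v < maxn m v + 1)%N by lia.
have [u [w [un wm G _]]] := cusp_generators mN.
by move=> /(span_elt un wm)[f fs fv]; apply/(G v vN); exists f.
Qed.

Lemma Lambda_cusp : exists u w : {poly R[i]},
  [/\ order_eq n u, order_eq m w & forall v, Lambda C v <->
      exists2 f, diff_module u w f & order_eq v f].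
Proof.
have [n2 nm co] := cusp_pair.
have n0 : n%:R != 0 :> R[i] by rewrite pnatr_eq0; lia.
have m0 : m%:R != 0 :> R[i] by rewrite pnatr_eq0; lia.
have mN : (m < (n * m).+1)%N by rewrite ltnS leq_pmull //; lia.
have [u [w [un wm _ L]]] := cusp_generators mN.
exists u, w; split=> // v; have [vN|vN] := ltnP v (n * m).+1; first exact: L.
have Gv : semigroup2 n m v by apply: semigroup2_large => //; lia.
split=> _.
  by apply: (diff_module_elt (n := n) (m := m)) => //; lia.
have mN' : (m < v.+1)%N by lia.
have [u' [w' [un' wm' _ L']]] := cusp_generators mN'.
apply/(L' v (ltnSn v)).
by apply: (diff_module_elt (n := n) (m := m)) => //; lia.
Qed.

End Cusp.

Lemma semimodule_gen_take n m (lam : seq nat) i : (i <= size lam)%N ->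
  semimodule_gen (semigroup2 n m) (take i lam) =
  first_gen (nth 0%N lam) (semigroup2 n m) i.
Proof.
move=> isz; have szt : size (take i lam) = i by rewrite size_takel.
apply/seteqP; split=> v.
  move=> [p [g [pl Gg ->]]]; exists (index p (take i lam)), g; split=> //.
    by rewrite -{2}szt index_mem.
  by rewrite -(nth_take 0%N (n0 := i)) ?nth_index // -{2}szt index_mem.
move=> [k [g [ki Gg ->]]]; exists (nth 0%N lam k), g; split=> //.
by rewrite -(nth_take 0%N ki) mem_nth // szt.
Qed.

Lemma axis_dir_axis_of n m (lam : seq nat) p i : (i <= size lam)%N ->
  axis_dir (semigroup2 n m) lam p i = axis_of n m (nth 0%N lam) p i.
Proof. by move=> isz; rewrite /axis_dir semimodule_gen_take. Qed.

Lemma basis_irredundant n m (L : set nat) (lam : seq nat) i :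
  is_basis (semigroup2 n m) L lam -> (i < size lam)%N ->
  ~ first_gen (nth 0%N lam) (semigroup2 n m) i (nth 0%N lam i).
Proof.
move=> [srt LE minl] isz [k [h [ki Gh lE]]].
pose mu := take i lam ++ drop i.+1 lam.
have lamE : lam = take i lam ++ nth 0%N lam i :: drop i.+1 lam.
  by rewrite -drop_nth // cat_take_drop.
have mu_sub : subseq mu lam.
  by rewrite [X in subseq _ X]lamE cat_subseq // subseq_cons.
have muL : L = semimodule_gen (semigroup2 n m) mu.
  rewrite LE; apply/seteqP; split=> v [p [g [pl Gg ->]]]; last first.
    by exists p, g; split=> //; apply: (mem_subseq mu_sub).
  move: pl; rewrite {1}lamE mem_cat inE orbCA -mem_cat => /orP[/eqP ->|pl].
    exists (nth 0%N lam k), (h + g)%N; split; last by rewrite lE addnA.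
      by rewrite mem_cat -(nth_take 0%N ki) mem_nth // size_takel // ltnW.
    exact: semigroup2D.
  by exists p, g.
have := minl mu (subseq_sorted ltn_trans mu_sub srt) muL.
by rewrite /mu size_cat size_takel ?size_drop; lia.
Qed.

Theorem lemma5p9 (R : realType) (m n : nat) (C : cusp R m n)
    (s : nat) (lam : seq nat)
    (hlam : is_basis (Gamma C) (Lambda C) lam) (hs : size lam = s.+2) :
  ((conductor (Lambda C))%:Z =
   (axis (Gamma C) lam m n s.+1)%:Z - n%:Z - m%:Z + 1)%R.
Proof.
have [n2 nm co] := cusp_pair C.
rewrite /axis; rewrite Gamma_cusp in hlam *.
have l_new i := basis_irredundant hlam (i := i).
have [srt LE _] := hlam.
set G := semigroup2 n m in LE l_new *.
have [u [w [un wm Lval]]] := Lambda_cusp C.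
have LD : Lambda C = first_gen (nth 0%N lam) G (size lam).
  by rewrite -semimodule_gen_take // take_size.
have l_mono i j : (i < j)%N -> (j < size lam)%N -> (nth 0%N lam i < nth 0%N lam j)%N.
  move=> ij jsz; apply: (sorted_ltn_nth ltn_trans) => //.
  by rewrite inE; apply: ltn_trans jsz.
have n0 : n%:R != 0 :> R[i]%C by rewrite pnatr_eq0; lia.
have m0 : m%:R != 0 :> R[i]%C by rewrite pnatr_eq0; lia.
have n_gt0 : (0 < n)%N by lia.
have m_gt0 : (0 < m)%N by lia.
have dun := order_eq_deriv n0 n_gt0 un.
have dwm := order_eq_deriv m0 m_gt0 wm.
have Lge v : Lambda C v -> (n <= v)%N.
  move=> /Lval[_ [a [b [_ _ ->]]] fv]; apply: order_ge_eq fv.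
  apply: order_geD; apply: order_geMr; first by case: dun.
  by apply: order_geW (ltnW nm) _; case: dwm.
have Ll i : (i < size lam)%N -> Lambda C (nth 0%N lam i).
  by move=> isz; rewrite LD; exists i, 0%N; split=> //; [exists 0%N, 0%N | rewrite addn0].
have Lelt v : G v -> (0 < v)%N -> Lambda C v.
  by move=> Gv v0; apply/Lval; apply: (diff_module_elt (n := n) (m := m)).
have l_le k : (k < size lam)%N -> (nth 0%N lam 0 <= nth 0%N lam k)%N.
  by case: k => // k ksz; apply/ltnW/l_mono.
have l0 : nth 0%N lam 0 = n.
  apply/eqP; rewrite eqn_leq Lge ?andbT; last by apply: Ll; rewrite hs.
  have : Lambda C n by apply: Lelt => //; exists 1%N, 0%N; lia.
  by rewrite LD => -[k [g [/l_le]]]; lia.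
have l1 : nth 0%N lam 1 = m.
  apply/eqP; rewrite eqn_leq; apply/andP; split.
    have : Lambda C m by apply: Lelt => //; exists 0%N, 1%N; lia.
    rewrite LD => -[[|k] [g [ksz [a [b ->]] mE]]].
      rewrite l0 in mE; have b0 : b = 0%N by case: b mE => // b; lia.
      have nm' : (n %| m)%N by rewrite mE b0 addn0 -mulSn dvdn_mull.
      by move: co; rewrite /coprime (gcdn_idPl nm'); lia.
    case: k ksz mE => [|k] ksz mE; first by lia.
    by have := l_mono 1%N k.+2 isT ksz; lia.
  rewrite leqNgt; apply/negP => lt.
  have sz1 : (1 < size lam)%N by rewrite hs.
  have /Lval[_ [a [b [Oa Ob ->]]] fv] := Ll _ sz1.
  apply: (l_new _ sz1).
  have av : order_eq (nth 0%N lam 1) (a * ('X * u^`())).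
    rewrite -[X in order_eq _ X](addrK (b * ('X * w^`()))).
    apply: order_eq_subl => //; apply: (order_geW lt).
    by apply: order_geMr; case: dwm.
  have [r ar ->] := order_eq_quot dun av.
  exists 0%N, r; split=> //; last by rewrite l0 addnC.
  exact: (span_order n_gt0 m_gt0 co un wm Oa ar).
have isz : (s.+1 <= size lam)%N by rewrite hs.
rewrite !axis_dir_axis_of // LD.
have l_basis v : first_gen (nth 0%N lam) G (size lam) v <->
    exists2 f, diff_module u w f & order_eq v f by rewrite -LD.
have := @conductor_basis _ _ (spanC u w) (@spanD _ u w) (@spanM _ u w) n m n2 nm co
  (fun f v => span_order n_gt0 m_gt0 co un wm (v := v) (f := f))
  (fun v => span_elt un wm (v := v)) _ _ dun dwm
  (nth 0%N lam) (size lam) l0 l1 l_mono l_new l_basis s.+1 isT hs.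
by rewrite -/G; move: (conductor _) (maxn _ _) => c h; lia.
Qed.
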